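(* Let $S$ be a compact surface without boundary and let $\mathcal A=\{Q_{\overline U}:U\in\mathcal U\}$ be an atlas, over a complete basis $\mathcal U$, of a dendritation of $S$. Then there is $\delta_0>0$ such that for every $\delta\in(0,\delta_0)$ and every open set $U\subset S$ with $\operatorname{diam}(U)<\delta$ such that $D=\overline U$ is a closed disc: each plaque $Q_D(x)$, $x\in D$, is a dendrite, and the quotient $D/Q_D$ (with the quotient topology) is a dendrite.
   Context: $S$ carries a metric compatible with its topology $\tau$. A continuum is a compact connected metric space; a Peano continuum is a locally connected continuum; a dendrite is a Peano continuum containing no simple closed curve. Let $X$ be a compact metric space (here $X=S$) with topology $\tau$. For $Y\subset X$ and $x\in Y$, $\operatorname{Comp}_x(Y)$ is the connected component of $Y$ containing $x$; $\mathcal C(Y)$ is the set of non-empty subcontinua of $Y$. A decomposition of a compact set $Y\subset X$ is a map $Q\colon Y\to\mathcal C(Y)$ with $x\in Q(x)$ for all $x$, any two values (plaques) equal or disjoint, and upper semicontinuous: for all $x\in Y$ and every open $V\supset Q(x)$ there is a neighborhood $W$ of $x$ with $Q(y)\subset V$ for all $y\in W\cap Y$. $Y/Q$ is the space of plaques with the quotient topology. If $Z\subset Y$, the monotone restriction is $Q|^m_Z(x)=\operatorname{Comp}_x(Q(x)\cap Z)$, $x\in Z$. Decompositions $Q_i$ of $Y_i$ ($i=1,2$) are compatible if $Q_1|^m_{Y_1\cap Y_2}=Q_2|^m_{Y_1\cap Y_2}$. An atlas over an open cover $\mathcal U$ of $X$ is a collection $\mathcal A=\{Q_{\overline U}\}_{U\in\mathcal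 U}$ of pairwise compatible decompositions $Q_{\overline U}$ of the closures $\overline U$. A basis $\mathcal U$ of $\tau$ is complete if $V\in\mathcal U$ and $U\subset V$ open imply $U\in\mathcal U$ (so, by compactness, all open sets of sufficiently small diameter belong to $\mathcal U$). Put $Q_U=Q_{\overline U}|^m_U$. For an atlas over a complete basis, the open plaques are the sets $Q_U(x)$ with $x\in U\in\mathcal U$. The leaf of $x$ is the set of $y$ for which there are open plaques $P_1,\dots,P_n$ with $x\in P_1$, $y\in P_n$ and $P_i\cap P_{i+1}\ne\emptyset$ for $1\le i<n$. The atlas is a Peano atlas if its open plaques are locally connected in the topology induced by $\tau$. It is a cw-atlas if (1) each leaf is a countable union of open plaques, (2) each leaf is a meagre subset of $(X,\tau)$, and (3) the diameters of the leaves are bounded away from zero. A Peano foliation is a maximal Peano atlas (maximal among Peano atlases, with respect to inclusion); it is always over a complete basis. A dendritation of $S$ is a Peano foliation of $S$ with (containing) a cw-atlas. An atlas of a dendritation is an atlas contained in it. *)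

(* Defs.v *)
From HB Require Import structures.
From mathcomp Require Import all_boot all_order all_algebra generic_quotient.
From mathcomp Require Import all_classical all_reals topology.

Set Implicit Arguments.
Unset Strict Implicit.
Unset Printing Implicit Defensive.

Import Order.TTheory GRing.Theory Num.Theory.
Import numFieldTopology.Exports.

Local Open Scope classical_set_scope.
Local Open Scope ring_scope.
Local Open Scope quotient_scope.

Definition homeomorphic (T U : topologicalType) : Prop :=
  exists (f : T -> U) (g : U -> T),
    [/\ cancel f g, cancel g f, continuous f & continuous g].

Definition metrizable (R : realType) (T : topologicalType) : Prop :=
  exists M : metricType R, homeomorphic T M.

Definition locally_connected (T : topologicalType) : Prop :=
  forall (x : T) (W : set T), nbhs x W ->
    exists V : set T, [/\ open V, V x, connected V & V `<=` W].

(* In what follows a set A : set T used as a space is [set_type A], which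
   carries the induced topology.  A continuum may be empty. *)

Definition continuum (R : realType) (T : topologicalType) : Prop :=
  [/\ metrizable R T, compact [set: T] & connected [set: T]].

Definition peano_continuum (R : realType) (T : topologicalType) : Prop :=
  continuum R T /\ locally_connected T.

Definition unit_circle (R : realType) : set (R * R) :=
  [set z | z.1 ^+ 2 + z.2 ^+ 2 = 1].

Definition closed_unit_disc (R : realType) : set (R * R) :=
  [set z | z.1 ^+ 2 + z.2 ^+ 2 <= 1].

Definition simple_closed_curve (R : realType) (T : topologicalType)
    (C : set T) : Prop :=
  homeomorphic (set_type C) (set_type (@unit_circle R)).

Definition closed_disc (R : realType) (T : topologicalType)
    (D : set T) : Prop :=
  homeomorphic (set_type D) (set_type (@closed_unit_disc R)).

Definition dendrite (R : realType) (T : topologicalType) : Prop :=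
  peano_continuum R T /\ ~ exists C : set T, simple_closed_curve R C.

(* Second countability and separation come with the compact metric; the
   charts onto open subsets of the plane exclude boundary points. *)
Definition compact_surface (R : realType) (S : metricType R) : Prop :=
  compact [set: S] /\
  forall x : S, exists (U : set S) (V : set (R * R)),
    [/\ open U, U x, open V & homeomorphic (set_type U) (set_type V)].

Definition diam (R : realType) (S : metricType R) (A : set S) : R :=
  sup [set mdist x y | x in A & y in A].

Definition nowhere_dense (T : topologicalType) (A : set T) : Prop :=
  interior (closure A) = set0.

Definition meagre (T : topologicalType) (A : set T) : Prop :=
  exists2 F : nat -> set T,
    (forall n, nowhere_dense (F n)) & A `<=` \bigcup_n F n.

(* Subsets of a metric space: metrizability is automatic. *)
Definition subcontinua (T : topologicalType) (Y : set T) : set (set T) :=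
  [set C | [/\ C !=set0, C `<=` Y, compact C & connected C]].

(* A map Y -> C(Y) is represented by a total Q : T -> set T whose values
   outside Y are irrelevant. *)
Definition decomposition (T : topologicalType) (Y : set T)
    (Q : T -> set T) : Prop :=
  [/\ forall x, Y x -> subcontinua Y (Q x) /\ Q x x,
      forall x y, Y x -> Y y -> Q x = Q y \/ Q x `&` Q y = set0 &
      forall x (V : set T), Y x -> open V -> Q x `<=` V ->
        \forall y \near x, Y y -> Q y `<=` V].

Definition mrestr (T : topologicalType) (Q : T -> set T) (Z : set T) :
    T -> set T :=
  fun x => connected_component (Q x `&` Z) x.

Definition compatible (T : topologicalType) (Y1 : set T) (Q1 : T -> set T)
    (Y2 : set T) (Q2 : T -> set T) : Prop :=
  forall x, (Y1 `&` Y2) x ->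
    mrestr Q1 (Y1 `&` Y2) x = mrestr Q2 (Y1 `&` Y2) x.

Definition plaque_rel (T : topologicalType) (Y : set T) (Q : T -> set T)
    (x y : set_type Y) : bool :=
  `[< Q (\val x) = Q (\val y) >].

Section PlaqueEquiv.
Context {T : topologicalType} (Y : set T) (Q : T -> set T).

Lemma plaque_rel_refl : reflexive (@plaque_rel T Y Q).
Proof. by move=> x; apply/asboolP. Qed.

Lemma plaque_rel_sym : symmetric (@plaque_rel T Y Q).
Proof. by move=> x y; apply/idP/idP => /asboolP e; apply/asboolP. Qed.

Lemma plaque_rel_trans : transitive (@plaque_rel T Y Q).
Proof. by move=> y x z /asboolP xy /asboolP yz; apply/asboolP; rewrite xy. Qed.

Canonical plaque_equiv :=
  EquivRel (@plaque_rel T Y Q) plaque_rel_refl plaque_rel_sym plaque_rel_trans.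

End PlaqueEquiv.

(* Y/Q: points of Y are identified when they have the same plaque. *)
Definition plaque_space (T : topologicalType) (Y : set T) (Q : T -> set T) :
    topologicalType :=
  quotient_topology {eq_quot (plaque_equiv Y Q)}.

(* For U in [atlas_cover A], the decomposition attached to U is
   [plaques A (closure U)].  Indexing by the closure loses nothing: compatible
   decompositions of the same closed set coincide.  Values at sets that are
   not the closure of a member of the cover, or at points outside that
   closure, are irrelevant. *)
Record atlas_data (T : topologicalType) := AtlasData {
  atlas_cover : set (set T);
  plaques : set T -> T -> set T
}.

Section Atlas.
Context {R : realType} {S : metricType R}.
Implicit Types (A B F : atlas_data S) (U V P : set S) (x y : S).

Definition is_atlas A : Prop :=
  [/\ atlas_cover A `<=` open,
      \bigcup_(U in atlas_cover A) U = [set: S],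
      forall U, atlas_cover A U ->
        decomposition (closure U) (plaques A (closure U)) &
      forall U V, atlas_cover A U -> atlas_cover A V ->
        compatible (closure U) (plaques A (closure U))
                   (closure V) (plaques A (closure V))].

Definition complete_basis (UU : set (set S)) : Prop :=
  basis UU /\ forall U V, UU V -> open U -> U `<=` V -> UU U.

Definition subatlas A B : Prop :=
  forall U, atlas_cover A U -> atlas_cover B U /\
    forall x, closure U x ->
      plaques A (closure U) x = plaques B (closure U) x.

Definition open_plaque A P : Prop :=
  exists U x,
    [/\ atlas_cover A U, U x & P = mrestr (plaques A (closure U)) U x].

Definition leaf A x : set S :=
  [set y | exists (n : nat) (P : nat -> set S),
    [/\ forall i, (i <= n)%N -> open_plaque A (P i),
        P 0%N x, P n y &
        forall i, (i < n)%N -> P i `&` P i.+1 !=set0]].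

Definition complete_atlas A : Prop :=
  is_atlas A /\ complete_basis (atlas_cover A).

Definition peano_atlas A : Prop :=
  complete_atlas A /\
  forall P, open_plaque A P -> locally_connected (set_type P).

Definition cw_atlas A : Prop :=
  [/\ complete_atlas A,
      forall x, exists PP : set (set S),
        [/\ countable PP, PP `<=` open_plaque A &
            leaf A x = \bigcup_(P in PP) P],
      forall x, meagre (leaf A x) &
      exists2 e : R, 0 < e & forall x, e <= diam (leaf A x)].

Definition peano_foliation F : Prop :=
  peano_atlas F /\ forall B, peano_atlas B -> subatlas F B -> subatlas B F.

Definition dendritation F : Prop :=
  peano_foliation F /\ exists2 B, cw_atlas B & subatlas B F.

End Atlas.

(* Main.v *)
(* Leaves of the cw-atlas B have diameter at least e, so in a disc D of diameter
   less than e no plaque lies in the interior of D (boundary bumping).  Planar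
   topology enters through Janiszewski's theorem only: if X and Y are continua
   in D and their intersection is disconnected, then D contains a nonempty open
   set O off X u Y whose frontier lies in X u Y.  A connected set which meets O
   and misses X u Y stays in O.
   - If X and Y lie in one plaque, any y in O off that plaque (plaques are
     meagre) has its plaque inside O, which is impossible.  So plaques are
     hereditarily unicoherent; this excludes simple closed curves, and makes a
     plaque locally connected, because an open plaque is.
   - A simple closed curve in D/Q is a union of two arcs meeting in two points;
     their preimages X and Y are continua, as plaques are connected, and their
     intersection is disconnected.  The plaque of any y in O is inside O.
   The remaining properties of D/Q are those of any Hausdorff quotient of a
   locally connected compact metric space. *)
From HB Require Import structures.
Require Import Defs.
From mathcomp Require Import all_boot all_order all_algebra generic_quotient.
From mathcomp Require Import finmap all_classical all_reals topology.
From mathcomp Require Import normedtype numfun trigo realfun ring lra.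

Set Implicit Arguments.
Unset Strict Implicit.
Unset Printing Implicit Defensive.

Import Order.TTheory GRing.Theory Num.Theory.
Import numFieldTopology.Exports numFieldNormedType.Exports.

Local Open Scope classical_set_scope.
Local Open Scope ring_scope.

(** * Continuous arguments of nonvanishing planar maps *)

Section Argument.
Context {R : realType}.
Implicit Types (z w : R * R) (T : topologicalType).

(** The obstacle is that [D] is known only up to homeomorphism: nothing says how it sits in a chart,
    in particular not that its complement there is connected. Separation is therefore measured by a
    property of the set itself, the existence of a continuous argument for every nonvanishing map to
    the plane. A disc has it because it contracts, homeomorphisms preserve it, and it fails on a
    compact set that encloses a point off it; this is what forces [O] into [D]. The decisive maps
    are the quotients (z - m)/(z - n), replaced by [cmul (z - m) (conjp (z - n))], which differs
    from them by a positive factor. Local connectedness of a plaque of [D] cannot be read off from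
    [U], whose open plaques stop short of the frontier. It comes from a larger [V], and unicoherence
    is then needed for continua in a chart disc [E] between [D] and [V]. Leaf size and meagreness
    are given for the cw-atlas only, so plaques of the foliation are compared with leaves of that
    atlas. *)

Definition cmul z w : R * R := (z.1 * w.1 - z.2 * w.2, z.1 * w.2 + z.2 * w.1).
Definition conjp z : R * R := (z.1, - z.2).
Definition nsq z : R := z.1 ^+ 2 + z.2 ^+ 2.
Definition polar (r t : R) : R * R := (r * cos t, r * sin t).

(* Lifts through exp(i t) of f / |f|; the modulus r need not be continuous. *)
Definition has_arg T (K : set T) (f : T -> R * R) :=
  exists2 th : T -> R, {within K, continuous th} &
    forall x, K x -> exists2 r : R, 0 < r & f x = polar r (th x).

Lemma nsq_gt0 z : z != 0 -> 0 < nsq z.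
Proof.
case: z => a b nz; rewrite /nsq /= lt_neqAle addr_ge0 ?sqr_ge0// andbT eq_sym.
rewrite paddr_eq0 ?sqr_ge0// !sqrf_eq0; apply: contra nz => /andP[/eqP-> /eqP->].
by apply/eqP.
Qed.

Lemma polar_neq0 (r t : R) : 0 < r -> polar r t != 0.
Proof.
move=> r0; apply/eqP => -[/eqP + /eqP].
rewrite !mulf_eq0 gt_eqF//= => /eqP c0 /eqP s0.
by have := cos2Dsin2 t; rewrite c0 s0 expr0n addr0 => /esym/eqP; rewrite oner_eq0.
Qed.

Lemma has_argM T (K : set T) f g : has_arg K f -> has_arg K g ->
  has_arg K (fun x => cmul (f x) (g x)).
Proof.
move=> [a ca fa] [b cb gb]; exists (fun x => a x + b x).
  by move=> x; apply: (@cvgD R R^o); [exact: ca|exact: cb].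
move=> x Kx; have [r r0 ->] := fa x Kx; have [s s0 ->] := gb x Kx.
exists (r * s); first exact: mulr_gt0.
by rewrite /cmul /polar/= cosD sinD; congr (_, _); ring.
Qed.

Lemma has_arg_conj T (K : set T) f : has_arg K f ->
  has_arg K (fun x => conjp (f x)).
Proof.
move=> [a ca fa]; exists (fun x => - a x).
  by move=> x; apply: (@cvgN R R^o); exact: ca.
move=> x Kx; have [r r0 ->] := fa x Kx; exists r => //.
by rewrite /conjp /polar/= cosN sinN mulrN.
Qed.

(** A positive factor leaves the argument alone, and [c] may vary with the point without any
    continuity. *)
Lemma has_arg_scale T (K : set T) f g : has_arg K f ->
  (forall x, K x -> exists2 c : R, 0 < c & f x = (c * (g x).1, c * (g x).2)) ->
  has_arg K g.
Proof.
move=> [a ca fa] fg; exists a => // x Kx.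
have [r r0 e] := fa x Kx; have [c c0 e'] := fg x Kx.
exists (r / c); first exact: divr_gt0.
move: e; rewrite e' /polar => -[e1 e2]; rewrite [g x]surjective_pairing.
by rewrite ![r / c * _]mulrAC -e1 -e2 ![c * _ / c]mulrAC divff ?gt_eqF// !mul1r.
Qed.

Lemma has_argW T (K L : set T) f : K `<=` L -> has_arg L f -> has_arg K f.
Proof.
move=> KL [a ca fa]; exists a; first exact: continuous_subspaceW ca.
by move=> x /KL/fa.
Qed.

Lemma has_arg_eq T (K : set T) f g : (forall x, K x -> f x = g x) ->
  has_arg K f -> has_arg K g.
Proof. by move=> e [a ca fa]; exists a => // x Kx; rewrite -e//; exact: fa. Qed.

(** On the right half plane the arctangent of the slope is a continuous branch of the argument. *)
Lemma has_arg_right T (K : set T) (f : T -> R * R) : {within K, continuous f} ->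
  (forall x, K x -> 0 < (f x).1) -> has_arg K f.
Proof.
move=> cf f0; exists (fun x => atan ((f x).2 / (f x).1)).
  apply/subspace_continuousP => x Kx.
  have cfx := (subspace_continuousP _ _).1 cf x Kx.
  have c1 : (fun y => (f y).1) @ within K (nbhs x) --> (f x).1.
    exact: (cvg_comp _ _ cfx (@cvg_fst _ _ (nbhs (f x).1) (nbhs (f x).2) _)).
  have c2 : (fun y => (f y).2) @ within K (nbhs x) --> (f x).2.
    exact: (cvg_comp _ _ cfx (@cvg_snd _ _ (nbhs (f x).1) (nbhs (f x).2) _)).
  apply: (@continuous_cvg _ _ _ _ _ _ atan); first exact: continuous_atan.
  by apply: (@cvgM R) => //; apply: (@cvgV R) => //; rewrite gt_eqF// f0.
move=> x Kx; have := f0 x Kx; case: (f x) => a b /= a0.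
have ct : 0 < cos (atan (b / a)).
  by apply: cos_gt0_pihalf; rewrite atan_gtNpi2 atan_ltpi2.
exists (a / cos (atan (b / a))); first exact: divr_gt0.
rewrite /polar divfK ?gt_eqF//; congr (_, _).
have := atanK (b / a); rewrite /tan => e.
rewrite mulrAC -mulrA e mulrC divfK// gt_eqF//.
Qed.

End Argument.

(** * Homotopy invariance of arguments *)

Section Homotopy.
Context {R : realType}.
Implicit Types (z w : R * R) (T : topologicalType).

Lemma cvg_proj1 (T : Type) (U V : topologicalType) (F : set_system T)
    (f : T -> U * V) (z : U * V) : f @ F --> z -> (f x).1 @[x --> F] --> z.1.
Proof. by move=> cf; exact: (cvg_comp _ _ cf (cvg_fst (G := nbhs z.2))). Qed.

Lemma cvg_proj2 (T : Type) (U V : topologicalType) (F : set_system T)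
    (f : T -> U * V) (z : U * V) : f @ F --> z -> (f x).2 @[x --> F] --> z.2.
Proof. by move=> cf; exact: (cvg_comp _ _ cf (cvg_snd (F := nbhs z.1))). Qed.

Lemma cvg_pairP (T : Type) (U V : topologicalType) (F : set_system T)
    (FF : Filter F) (f : T -> U * V) (z : U * V) :
  (f x).1 @[x --> F] --> z.1 -> (f x).2 @[x --> F] --> z.2 -> f @ F --> z.
Proof.
move=> c1 c2; rewrite (_ : f = fun x => ((f x).1, (f x).2)).
  exact: (@cvg_pair _ _ _ F (nbhs z.1) (nbhs z.2) _ _ _ _ _ c1 c2).
by apply/funext => x; case: (f x).
Qed.

Lemma cvg_cmul (T : Type) (F : set_system T) (FF : Filter F) (f g : T -> R * R) z w :
  f @ F --> z -> g @ F --> w -> cmul (f x) (g x) @[x --> F] --> cmul z w.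
Proof.
move=> cf cg; have f1 := cvg_proj1 cf; have f2 := cvg_proj2 cf.
have g1 := cvg_proj1 cg; have g2 := cvg_proj2 cg.
apply: cvg_pairP; first by apply: (@cvgB R R^o); apply: (@cvgM R).
by apply: (@cvgD R R^o); apply: (@cvgM R).
Qed.

Lemma cvg_conjp (T : Type) (F : set_system T) (FF : Filter F) (f : T -> R * R) z :
  f @ F --> z -> conjp (f x) @[x --> F] --> conjp z.
Proof.
move=> cf; apply: cvg_pairP; first exact: cvg_proj1 cf.
by apply: (@cvgN R R^o); exact: cvg_proj2 cf.
Qed.

Lemma polar_ex z : z != 0 -> exists2 r : R, 0 < r & exists t, z = polar r t.
Proof.
have right (u : R * R) : 0 < u.1 -> exists2 r : R, 0 < r & exists t, u = polar r t.
  move=> u0; have [] := @has_arg_right R R setT (fun=> u).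
  - by apply: continuous_subspaceT => x; exact: cvg_cst.
  - by [].
  - by move=> th _ /(_ 0 I)[r r0 ->]; exists r => //; exists (th 0).
case: z => a b nz; have [a0|a0|a0] := ltgtP a 0.
- have [|r r0 [t [e1 e2]]] := right (- a, - b); first by rewrite /= oppr_gt0.
  exists r => //; exists (t + pi); rewrite /polar cosDpi sinDpi !mulrN -e1 -e2.
  by rewrite !opprK.
- exact: right.
- have b0 : b != 0 by apply: contra nz => /eqP ->; rewrite a0.
  have cs : cos (pi / 2) = 0 :> R by rewrite cos_pihalf.
  have ss : sin (pi / 2) = 1 :> R by rewrite sin_pihalf.
  case/orP: (lt_total b0) => b1.
    exists (- b); first by rewrite oppr_gt0.
    by exists (- (pi / 2)); rewrite /polar cosN sinN cs ss a0 mulr0 mulrN1 opprK.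
  by exists b => //; exists (pi / 2); rewrite /polar cs ss a0 mulr0 mulr1.
Qed.

(** Having an argument for the ratio of two slices is an equivalence relation on the parameters in
    [C]. Its classes are open: [K] being compact, for [t] near [s] the ratio stays in the right half
    plane over all of [K]. A connected [C] is then a single class. *)
Lemma has_arg_homotopy (X T : topologicalType) (K : set X) (C : set T)
    (G : X * T -> R * R) (p q : T) :
  compact K -> connected C -> {within K `*` C, continuous G} ->
  (forall x t, K x -> C t -> G (x, t) != 0) -> C p -> C q ->
  has_arg K (fun x => cmul (G (x, p)) (conjp (G (x, q)))).
Proof.
move=> cK cC cG G0 Cp Cq.
pose H s t := has_arg K (fun x => cmul (G (x, s)) (conjp (G (x, t)))).
have cGs s : C s -> {within K, continuous (fun x => G (x, s))}.
  move=> Cs; apply/subspace_continuousP => x Kx.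
  have /subspace_continuousP/(_ (x, s) (conj Kx Cs)) cGx := cG.
  apply: cvg_comp cGx => W [[A B] /= [Ax Bs] AB].
  have {AB} AB : A `*` B `<=` [set z | (K `*` C) z -> W z] by [].
  by apply: filterS Ax => y Ay Ky; apply: (AB (y, s)); split=> //=;
    exact: nbhs_singleton.
have loc s : C s -> \forall t \near s, C t -> H s t.
  move=> Cs; have /compact_near_coveringP/near_covering_withinP nK := cK.
  have := nK T (within C (nbhs s))
    (fun t x => 0 < (cmul (G (x, s)) (conjp (G (x, t)))).1) _.
  have /[swap]/[apply] : forall x, K x -> \forall x' \near x & t \near within C (nbhs s),
      K x' -> 0 < (cmul (G (x', s)) (conjp (G (x', t)))).1.
    move=> x Kx.
    (* A nonzero number times its own conjugate is a positive real, so two values close to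
       [G (x, s)] still have a ratio with positive real part. *)
    have [e e0 Ae] : exists2 e : R, 0 < e & forall v w,
        ball (G (x, s)) e v -> ball (G (x, s)) e w -> 0 < (cmul v (conjp w)).1.
      have : (fun vw : (R * R) * (R * R) => (cmul vw.1 (conjp vw.2)).1) @
          nbhs (G (x, s), G (x, s)) --> (cmul (G (x, s)) (conjp (G (x, s)))).1.
        apply: cvg_proj1; apply: cvg_cmul.
          exact: (cvg_proj1 (f := idfun) (z := (G (x, s), G (x, s)))).
        apply: cvg_conjp.
        exact: (cvg_proj2 (f := idfun) (z := (G (x, s), G (x, s)))).
      have pos : 0 < (cmul (G (x, s)) (conjp (G (x, s)))).1.
        by rewrite /= mulrN opprK -!expr2; apply: nsq_gt0; exact: G0.
      move=> /(_ _ (lt_nbhsr pos)) /nbhs_ballP[e /= e0 eb].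
      by exists e => // v w vb wb; apply: (eb (v, w)); split.
    have /subspace_continuousP/(_ (x, s) (conj Kx Cs)) cGx := cG.
    have := cGx _ (nbhsx_ballx _ _ e0) => -[[A B] /= [Ax Bs] AB].
    have {}AB y t : A y -> B t -> K y -> C t -> ball (G (x, s)) e (G (y, t)).
      by move=> Ay Bt Ky Ct; exact: (AB (y, t)).
    exists (A, [set t | C t /\ B t]) => /=.
      by split=> //; rewrite /within; apply: filterS Bs => t Bt Ct.
    move=> [y t] /= [Ay [Ct Bt]] Ky; apply: Ae; apply: AB => //.
    exact: nbhs_singleton.
  rewrite near_withinE; apply: filterS => t + Ct => /(_ Ct) h.
  apply: has_arg_right; last by move=> x Kx; exact: h.
  apply/subspace_continuousP => x Kx.
  apply: cvg_cmul; first exact: (subspace_continuousP _ _).1 (cGs s Cs) x Kx.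
  by apply: cvg_conjp; exact: (subspace_continuousP _ _).1 (cGs t Ct) x Kx.
have trans s t u : C s -> C t -> C u -> H s t -> H t u -> H s u.
  move=> Cs Ct Cu st tu; apply: has_arg_scale (has_argM st tu) _ => x Kx.
  exists (nsq (G (x, t))); first exact/nsq_gt0/G0.
  by rewrite /cmul /conjp /nsq /=; congr (_, _); ring.
have sym s t : C s -> C t -> H s t -> H t s.
  move=> Cs Ct /has_arg_conj; apply: has_arg_eq => x Kx.
  by rewrite /cmul /conjp/=; congr (_, _); ring.
have refl s : C s -> H s s.
  by move=> Cs; exact: nbhs_singleton (loc s Cs) Cs.
suff e : [set t | C t /\ H p t] = C by have : C q by []; rewrite -e => -[].
(* The relation and its negation are both open in [C]: [V true] and the complement of [V false] cut
   the same subset out of [C], one as an open and one as a closed set. *)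
pose V b := [set t | C t -> (if b then H p t else ~ H p t)]°.
have VE b t : C t -> (if b then H p t else ~ H p t) -> V b t.
  move=> Ct pt; apply: filterS (loc t Ct) => u Htu Cu; case: b pt => pt.
    exact: trans (Htu Cu).
  by move=> pu; apply: pt; apply: (trans p u t) => //; exact/sym/Htu.
apply: cC; first by exists p; split=> //; exact: refl.
- exists (V true); first exact: open_interior.
  apply/seteqP; split=> t [Ct pt]; first by split=> //; exact: (VE true).
  by split=> //; exact: (interior_subset pt).
- exists (~` V false); first exact/open_closedC/open_interior.
  apply/seteqP; split=> t [Ct pt]; split=> //.
    by move=> /interior_subset /(_ Ct); exact.
  by apply: contrapT => npt; apply: pt; exact: (VE false).
Qed.

End Homotopy.

(** * Planar sets with and without arguments *)

Section ArgumentExistence.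
Context {R : realType}.
Implicit Types (z w c p q : R * R).

Lemma within_comp (X Y Z : topologicalType) (A : set X) (B : set Y)
    (h : X -> Y) (f : Y -> Z) : (forall x, A x -> B (h x)) ->
  {within A, continuous h} -> {within B, continuous f} ->
  {within A, continuous (f \o h)}.
Proof.
move=> hAB ch cf; apply/subspace_continuousP => x Ax.
have chx := (subspace_continuousP _ _).1 ch x Ax.
have cfx := (subspace_continuousP _ _).1 cf _ (hAB x Ax).
move=> W /cfx BW.
have {}BW : \forall y \near x, A y -> B (h y) -> W (f (h y)) := chx _ BW.
suff : \forall y \near x, A y -> W (f (h y)) by [].
by apply: filterS BW => y k Ay; apply: k => //; exact: hAB.
Qed.

(** For [u] in [C] the map [z - u] has no zero on [K], so homotopy invariance applies with [C]
    itself as parameter space. *)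
Lemma has_arg_ratio (K C : set (R * R)) p q :
  compact K -> connected C -> C `&` K = set0 -> C p -> C q ->
  has_arg K (fun z => cmul (z - p) (conjp (z - q))).
Proof.
move=> cK cC CK Cp Cq.
apply: (@has_arg_homotopy R _ _ K C (fun u => u.1 - u.2)) => //.
  apply: continuous_subspaceT => u.
  by apply: (@cvgB R (R * R)%type); [exact: cvg_fst|exact: cvg_snd].
move=> x t Kx Ct /=; rewrite subr_eq0; apply/eqP => xt.
by have : (C `&` K) t; [split=> //; rewrite -xt|rewrite CK].
Qed.

Definition segm c z (t : R) : R * R :=
  (c.1 + t * (z.1 - c.1), c.2 + t * (z.2 - c.2)).

Definition star_shaped c (K : set (R * R)) :=
  forall z, K z -> forall t : R, 0 <= t <= 1 -> K (segm c z t).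

(** Shrinking [K] to [c] along segments is a homotopy from [f] to the constant [f c], which has a
    constant argument. *)
Lemma has_arg_star c (K : set (R * R)) (f : R * R -> R * R) :
  compact K -> star_shaped c K -> {within K, continuous f} ->
  (forall z, K z -> f z != 0) -> has_arg K f.
Proof.
move=> cK sK cf f0.
have [->|/set0P[z0 Kz0]] := eqVneq K set0.
  by exists (fun=> 0); [exact: continuous_subspace0|].
have Kc : K c.
  have := sK _ Kz0 0; rewrite lexx ler01 /segm !mul0r !addr0 -surjective_pairing.
  exact.
have [r r0 [t0 e]] := polar_ex (f0 _ Kc).
pose I := `[0, 1]%classic : set R.
have h : has_arg K (fun z => cmul (f (segm c z 1)) (conjp (f (segm c z 0)))).
  apply: (@has_arg_homotopy R _ _ K I (fun u => f (segm c u.1 u.2))) => //.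
  - exact: segment_connected.
  - apply: (within_comp (h := fun u => segm c u.1 u.2) _ _ cf).
      by move=> [x t] [/= Kx It]; exact: sK.
    apply: continuous_subspaceT => u; apply: cvg_pairP => /=.
      apply: (@cvgD R R^o); first exact: cvg_cst.
      apply: (@cvgM R); first exact: cvg_snd.
      apply: (@cvgB R R^o); last exact: cvg_cst.
      by apply: cvg_proj1; exact: cvg_fst.
    apply: (@cvgD R R^o); first exact: cvg_cst.
    apply: (@cvgM R); first exact: cvg_snd.
    apply: (@cvgB R R^o); last exact: cvg_cst.
    by apply: cvg_proj2; exact: cvg_fst.
  - by move=> x t Kx It; apply/f0/sK.
  - by rewrite /I /= in_itv /= lexx ler01.
  - by rewrite /I /= in_itv /= lexx ler01.
have k : has_arg K (fun=> f c).
  exists (fun=> t0); first by apply: continuous_subspaceT => x; exact: cvg_cst.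
  by move=> _ _; exists r.
apply: has_arg_scale (has_argM h k) _ => z Kz; exists (nsq (f c)).
  exact/nsq_gt0/f0.
rewrite /segm !mul0r !addr0 !mul1r ![_ + (_ - _)]addrC !subrK -!surjective_pairing.
by rewrite /cmul /conjp /nsq /=; congr (_, _); ring.
Qed.

(** The values of [k] are multiples of 2 pi, a discrete set, and the intermediate value property
    forbids two of them. *)
Lemma cos1_cst (T : topologicalType) (C : set T) (k : T -> R) :
  connected C -> {within C, continuous k} -> (forall x, C x -> cos (k x) = 1) ->
  forall x y, C x -> C y -> k x = k y.
Proof.
move=> cC ck k1.
suff key x y : C x -> C y -> ~ k x < k y.
  move=> x y Cx Cy; apply/eqP; rewrite eq_le !leNgt.
  by apply/andP; split; apply/negP; exact: key.
move=> Cx Cy xy.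
have /connected_intervalP itv := connected_continuous_connected cC ck.
(* Capping the increment at [pi] keeps it where [cos] is injective, so that [cos s = 1] forces
   [s = 0]. *)
pose s := Num.min (k y - k x) pi.
have s0 : 0 < s by rewrite lt_min subr_gt0 xy pi_gt0.
have [|z Cz kz] := itv _ _ (imageP k Cx) (imageP k Cy) (k x + s).
  by rewrite lerDl ltW//= -lerBrDl ge_min lexx.
have := k1 z Cz; rewrite kz cosD k1// (cos1sin0 _) ?k1 ?normr1// mul0r subr0 mul1r.
rewrite -cos0 => /cos_inj; rewrite !in_itv/= lexx pi_ge0 (ltW s0) ge_min lexx orbT.
by move=> /(_ isT isT) s0'; rewrite s0' ltxx in s0.
Qed.

Lemma polar_inj (r s a b : R) : 0 < r -> 0 < s -> polar r a = polar s b ->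
  r = s /\ cos (a - b) = 1.
Proof.
move=> r0 s0 [e1 e2].
have rs : r = s.
  have : nsq (polar r a) = nsq (polar s b) by rewrite /polar e1 e2.
  rewrite /nsq /= !exprMn -!mulrDr !cos2Dsin2 !mulr1 => /eqP.
  by rewrite eqf_sqr => /orP[/eqP//|/eqP rs]; move: r0; rewrite rs oppr_gt0 ltNge ltW.
split=> //; rewrite -rs in e1 e2.
have r' : r != 0 by rewrite gt_eqF.
by rewrite cosB (mulfI r' e1) (mulfI r' e2) -!expr2 cos2Dsin2.
Qed.

(** Along the parametrized circle an argument would differ from [t] by a multiple of 2 pi, hence by
    a constant, although the circle closes up after 2 pi. *)
Lemma circle_no_arg c (r : R) : 0 < r ->
  ~ has_arg [set c + polar r t | t in [set: R]] (fun z => z - c).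
Proof.
move=> r0 [th cth h].
pose k t := th (c + polar r t) - t.
have ck : {within setT, continuous k}.
  move=> t; apply: (@cvgB R R^o); last first.
    by apply: continuous_subspaceT => u; exact: cvg_id.
  apply: (within_comp (h := fun t => c + polar r t) _ _ cth).
    by move=> u _; exists u.
  apply: continuous_subspaceT => u.
  apply: (@cvgD R (R * R)%type); first exact: cvg_cst.
  apply: cvg_pairP; apply: (@cvgM R); try exact: cvg_cst.
    exact: continuous_cos.
  exact: continuous_sin.
have k1 t : setT t -> cos (k t) = 1.
  move=> _; have [|s s0 e] := h (c + polar r t); first by exists t.
  move: e; rewrite addrC addKr => /esym e.
  by have [] := polar_inj s0 r0 e.
have kR : connected [set: R] by apply/connected_intervalP.
have := cos1_cst kR ck k1 (x := 0) (y := 0 + pi *+ 2) I I.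
rewrite /k /polar cosD2pi sinD2pi => /addrI/oppr_inj /eqP.
by rewrite add0r eq_sym mulrn_eq0/= gt_eqF// pi_gt0.
Qed.

End ArgumentExistence.

(** * Obstruction on the frontier of a bounded open set *)

Section Winding.
Context {R : realType}.
Implicit Types (z w c m n p q : R * R).

Definition unitp z : R * R :=
  (z.1 / Num.sqrt (nsq z), z.2 / Num.sqrt (nsq z)).

Lemma nsq_polar (r t : R) : nsq (polar r t) = r ^+ 2.
Proof. by rewrite /nsq /= !exprMn -mulrDr cos2Dsin2 mulr1. Qed.

Lemma unitp_polar (r t : R) : 0 < r -> unitp (polar r t) = polar 1 t.
Proof.
move=> r0; rewrite /unitp nsq_polar sqrtr_sqr gtr0_norm//.
by rewrite /polar/= ![r * _]mulrC !mulfK ?mul1r// gt_eqF.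
Qed.

Lemma polar_cos1 (r a b : R) : cos (a - b) = 1 -> polar r a = polar r b.
Proof.
move=> c1; have s0 : sin (a - b) = 0 by rewrite cos1sin0// c1 normr1.
rewrite -[a](subrK b) /polar (cosD (a - b)) (sinD (a - b)) c1 s0.
by rewrite !(mul0r, mul1r, subr0, add0r).
Qed.

Lemma cvg_unitp (T : Type) (F : set_system T) (FF : Filter F) (f : T -> R * R) z :
  z != 0 -> f @ F --> z -> unitp (f x) @[x --> F] --> unitp z.
Proof.
move=> z0 cf; have c1 := cvg_proj1 cf; have c2 := cvg_proj2 cf.
have cn : (Num.sqrt (nsq (f x)))^-1 @[x --> F] --> (Num.sqrt (nsq z))^-1.
  apply: cvgV; first by rewrite gt_eqF// sqrtr_gt0 nsq_gt0.
  apply: (@continuous_cvg _ _ _ _ _ _ Num.sqrt); first exact: sqrt_continuous.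
  by apply: (@cvgD R R^o); apply: (@cvgM R).
by apply: cvg_pairP; apply: (@cvgM R).
Qed.

(** Recovers the direction of [z] from that of [w] and an argument of their ratio; this makes the
    two formulas for [G] below agree on the frontier. *)
Lemma unitp_ratio z w (r t : R) : z != 0 -> w != 0 -> 0 < r ->
  cmul z (conjp w) = polar r t -> unitp z = cmul (polar 1 t) (unitp w).
Proof.
move=> /polar_ex[a a0 [al ->]] /polar_ex[b b0 [be ->]] r0.
have -> : cmul (polar a al) (conjp (polar b be)) = polar (a * b) (al - be).
  by rewrite /cmul /conjp /polar /= cosB sinB; congr (_, _); ring.
move=> /(polar_inj (mulr_gt0 a0 b0) r0)[_ c1].
rewrite !unitp_polar// (_ : cmul _ _ = polar 1 (t + be)).
  by apply: polar_cos1; rewrite opprD addrA addrAC.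
by rewrite /cmul /polar /= cosD sinD; congr (_, _); ring.
Qed.

Definition box c (r : R) : set (R * R) :=
  [set z | `|z.1 - c.1| <= r /\ `|z.2 - c.2| <= r].

Lemma box_setX c r :
  box c r = `[c.1 - r, c.1 + r]%classic `*` `[c.2 - r, c.2 + r]%classic.
Proof.
by apply/seteqP; split=> z; rewrite /box/= !in_itv/= !ler_distl => -[].
Qed.

Lemma box_compact c r : compact (box c r).
Proof. by rewrite box_setX; apply: compact_setX; exact: segment_compact. Qed.

Lemma box_star c r : star_shaped c (box c r).
Proof.
have key (a b t : R) : 0 <= t <= 1 -> `|b - a| <= r -> `|a + t * (b - a) - a| <= r.
  move=> /andP[t0 t1] h; rewrite addrAC subrr add0r normrM ger0_norm//.
  by rewrite (le_trans _ h)// ler_piMl.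
by move=> z [z1 z2] t t01; split; exact: key.
Qed.

Lemma continuous_compact_norm_bounded (F : set (R * R)) (th : R * R -> R) :
  compact F -> {within F, continuous th} ->
  exists2 M : R, 0 < M & forall z, F z -> `|th z| <= M.
Proof.
move=> cF cth; have := continuous_compact cth cF.
move=> /compact_bounded/ex_strict_bound_gt0[M M0 h].
by exists M => // z Fz; apply/ltW/h; exists z.
Qed.

(* A continuous argument of (z - m)/(z - n) on F would, after Tietze
   extension over O, give an argument of z - m on a large circle. *)
Lemma surround_no_arg (O F : set (R * R)) m n (r : R) :
  open O -> compact F -> O `<=` box m r -> closure O `<=` O `|` F ->
  O m -> ~ O n -> ~ F n ->
  ~ has_arg F (fun z => cmul (z - m) (conjp (z - n))).
Proof.
move=> oO cF Or clO Om On Fn [th cth h].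
have [M M0 thM] := continuous_compact_norm_bounded cF cth.
have clF : closed F by apply: compact_closed => //; exact: norm_hausdorff.
have [Th [thTh cTh _]] := continuous_bounded_extension
  (@pseudometric_normal R (R * R)%type) clF M0 cth thM.
have r0 : 0 <= r by have [] := Or _ Om; rewrite subrr normr0.
pose g1 z := cmul (polar 1 (Th z)) (unitp (z - n)).
pose g2 z := unitp (z - m).
(* Inside [O] the direction of [z - n] is turned by the extended argument; outside, the direction of
   [z - m] is kept. This removes the zero of [z - m] at [m], so [G] vanishes nowhere. *)
pose G z := if `[<O z>] then g1 z else g2 z.
have Fm z : F z -> ~ O z -> z - m != 0.
  by move=> _ Oz; rewrite subr_eq0; apply/eqP => zm; apply: Oz; rewrite zm.
have OFn z : (O `|` F) z -> z - n != 0.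
  by move=> OF; rewrite subr_eq0; apply/eqP => zn; rewrite zn in OF; case: OF.
have eqF z : F z -> ~ O z -> g1 z = g2 z.
  move=> Fz Oz; have [s s0 e] := h z Fz.
  rewrite /g1 /g2 -thTh ?inE//; apply/esym/(unitp_ratio _ _ s0 e).
    exact: Fm.
  by apply: OFn; right.
have cm : continuous (fun z : R * R => z - m).
  by move=> z; apply: (@cvgB R (R * R)%type); [exact: cvg_id|exact: cvg_cst].
have cn : continuous (fun z : R * R => z - n).
  by move=> z; apply: (@cvgB R (R * R)%type); [exact: cvg_id|exact: cvg_cst].
have cG : continuous G.
  apply/continuous_subspace_setT; rewrite -(setUv (O `|` F)).
  have -> : (O `|` F) `|` ~` (O `|` F) = (O `|` F) `|` ~` O.
    apply/seteqP; split=> z [|Oz]; [by left| |by left|].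
      by right=> Oz'; apply: Oz; left.
    by have [Fz|Fz] := pselect (F z); [left; right|right=> -[]].
  apply: withinU_continuous; last 2 first.
  - apply: (@subspace_eq_continuous _ _ _ g1).
      move=> z; rewrite inE => OFz; suff : g1 z = G z by [].
      rewrite /G; have [//|Oz] := asboolP (O z).
      by apply: eqF => //; case: OFz.
    apply: continuous_in_subspaceT => z; rewrite inE => OFz.
    apply: cvg_cmul; last by apply: cvg_unitp; [exact: OFn|exact: cn].
    apply: cvg_pairP; apply: (@cvgM R); try exact: cvg_cst.
      by apply: (@continuous_cvg _ _ _ _ _ _ cos); [exact: continuous_cos|exact: cTh].
    by apply: (@continuous_cvg _ _ _ _ _ _ sin); [exact: continuous_sin|exact: cTh].
  - apply: (@subspace_eq_continuous _ _ _ g2).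
      move=> z; rewrite inE => /= Oz; suff : g2 z = G z by [].
      by rewrite /G; have [] := asboolP (O z).
    apply: continuous_in_subspaceT => z; rewrite inE => Oz.
    apply: cvg_unitp; last exact: cm.
    by rewrite subr_eq0; apply/eqP => zm; apply: Oz; rewrite zm.
  - move=> z /= clz; have := closureU O F; rewrite predeqE => /(_ z)[+ _].
    by move=> /(_ clz)[/clO//|]; rewrite -(closure_id _).1//; right.
  - exact: open_closedC.
have unit0 z : z != 0 -> unitp z != 0.
  by move=> /polar_ex[a a0 [al ->]]; rewrite unitp_polar// polar_neq0.
have G0 z : G z != 0.
  rewrite /G; have [Oz|Oz] := asboolP (O z).
    rewrite /g1; have /polar_ex[a a0 [al ->]] := OFn z (or_introl Oz).
    rewrite unitp_polar// (_ : cmul _ _ = polar 1 (Th z + al)) ?polar_neq0//.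
    by rewrite /cmul /polar /= cosD sinD; congr (_, _); ring.
  apply: unit0; rewrite subr_eq0; apply/eqP => zm; apply: Oz.
  by rewrite zm.
(* Two coordinates of size at most [r] give a squared norm of at most [2 * r ^+ 2], which is less
   than [s ^+ 2]; the circle of radius [s] about [m] thus avoids [O]. *)
pose s := 2 * r + 1.
have s0 : 0 < s by rewrite /s; lra.
have argG : has_arg (box m s) G.
  apply: (has_arg_star (@box_compact m s) (@box_star m s)) => //.
  exact: continuous_subspaceT.
apply: (circle_no_arg (c := m) s0); set C := (X in has_arg X).
have CB : C `<=` box m s.
  move=> _ [t _ <-]; split => /=; rewrite addrC addKr normrM gtr0_norm//.
    by rewrite ler_piMr ?cos_max// ltW.
  by rewrite ler_piMr ?sin_max// ltW.
apply: has_arg_scale (has_argW CB argG) _ => _ [t _ <-].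
have CO : ~ O (m + polar s t).
  move=> /Or[/=]; rewrite ![m.1 + _]addrC ![m.2 + _]addrC !addrK => b1 b2.
  have := nsq_polar s t; rewrite /nsq /polar /=.
  rewrite -[(s * cos t) ^+ 2]real_normK ?num_real//.
  rewrite -[(s * sin t) ^+ 2]real_normK ?num_real//.
  by move: (normr_ge0 (s * cos t)) (normr_ge0 (s * sin t)); rewrite /s; nra.
exists s^-1; first by rewrite invr_gt0.
rewrite /G; case: (asboolP (O _)) => // _; rewrite /g2 addrC addKr unitp_polar//.
by rewrite /polar /= !mulKf ?gt_eqF// !mul1r.
Qed.

End Winding.

(** * Janiszewski's theorem *)

Section PlaneSeparation.
Context {R : realType}.
Implicit Types (z w c m n p q : R * R) (A B D K M N : set (R * R)).

Lemma star_connected c K : star_shaped c K -> connected K.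
Proof.
move=> sK; have [->|/set0P[z0 Kz0]] := eqVneq K set0; first exact: connected0.
have in01 (t : R) : `[0, 1]%classic t -> 0 <= t <= 1 by rewrite /= in_itv.
pose S z := [set segm c z t | t in `[0, 1]%classic].
have -> : K = \bigcup_(z in K) S z.
  apply/seteqP; split=> [z Kz|_ [z Kz [t /in01 t01 <-]]]; last exact: sK.
  exists z => //; exists 1; first by rewrite /= in_itv /= ler01 lexx.
  by rewrite /segm !mul1r ![_ + (_ - _)]addrC !subrK -surjective_pairing.
apply: bigcup_connected.
  exists c => z Kz; exists 0; first by rewrite /= in_itv /= ler01 lexx.
  by rewrite /segm !mul0r !addr0 -surjective_pairing.
move=> z Kz; apply: connected_continuous_connected; first exact: segment_connected.
apply: continuous_subspaceT => t; apply: cvg_pairP => /=.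
  apply: (@cvgD R R^o); first exact: cvg_cst.
  by apply: (@cvgM R); [exact: cvg_id|exact: cvg_cst].
apply: (@cvgD R R^o); first exact: cvg_cst.
by apply: (@cvgM R); [exact: cvg_id|exact: cvg_cst].
Qed.

Lemma nbhs_box c (W : set (R * R)) :
  nbhs c W -> exists2 r : R, 0 < r & box c r `<=` W.
Proof.
move=> /nbhs_ballP[e /= e0 eW]; exists (e / 2); first by rewrite divr_gt0.
move=> z [z1 z2]; apply: eW; split; rewrite /ball /= distrC.
  by apply: le_lt_trans z1 _; lra.
by apply: le_lt_trans z2 _; lra.
Qed.

Lemma box_nbhs c (r : R) : 0 < r -> nbhs c (box c r).
Proof.
move=> r0; apply/nbhs_ballP; exists r => //= z [z1 z2].
by split; rewrite distrC; apply/ltW.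
Qed.

Lemma compact_sub_box K : compact K -> exists2 r : R, 0 < r & K `<=` box 0 r.
Proof.
move=> cK; have c1 : {within K, continuous (fun z : R * R => z.1)}.
  by apply: continuous_subspaceT => z; exact: cvg_fst.
have c2 : {within K, continuous (fun z : R * R => z.2)}.
  by apply: continuous_subspaceT => z; exact: cvg_snd.
have [a a0 h1] := continuous_compact_norm_bounded cK c1.
have [b b0 h2] := continuous_compact_norm_bounded cK c2.
exists (a + b); first exact: addr_gt0.
move=> z Kz; rewrite /box /= !subr0; split.
  by apply: le_trans (h1 z Kz) _; rewrite lerDl ltW.
by apply: le_trans (h2 z Kz) _; rewrite lerDr ltW.
Qed.

(** Four half planes cover the exterior, each is star shaped, and they are listed so that each meets
    the union of those before it. *)
Lemma exterior_connected (r : R) : connected (~` box 0 r).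
Proof.
pose H1 := [set z : R * R | r < z.1]; pose H2 := [set z : R * R | r < z.2].
pose H3 := [set z : R * R | z.1 < - r]; pose H4 := [set z : R * R | z.2 < - r].
have -> : ~` box 0 r = H1 `|` H2 `|` H3 `|` H4.
  apply/seteqP; split=> z; rewrite /box /= !subr0 !ler_norml.
    move=> /not_andP[/negP|/negP]; rewrite negb_and -!ltNge => /orP[]; by
      [left; right|left; left; left|right|left; left; right].
  rewrite /H1 /H2 /H3 /H4 /=.
  by move=> [[[h|h]|h]|h] [/andP[a b] /andP[c d]]; lra.
have key (h t a b : R) : 0 <= t <= 1 -> h < a -> h < b -> h < a + t * (b - a).
  by move=> /andP[t0 t1] ha hb; have [ab|ab] := leP a b; nra.
have key' (h t a b : R) : 0 <= t <= 1 -> a < h -> b < h -> a + t * (b - a) < h.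
  by move=> /andP[t0 t1] ha hb; have [ab|ab] := leP a b; nra.
have h1 : connected H1.
  apply: (@star_connected (r + 1, 0)) => z Hz t t01; apply: key => //=.
  by rewrite ltrDl ltr01.
have h2 : connected H2.
  apply: (@star_connected (0, r + 1)) => z Hz t t01; apply: key => //=.
  by rewrite ltrDl ltr01.
have h3 : connected H3.
  apply: (@star_connected (- r - 1, 0)) => z Hz t t01; apply: key' => //=.
  by rewrite gtrDl oppr_lt0 ltr01.
have h4 : connected H4.
  apply: (@star_connected (0, - r - 1)) => z Hz t t01; apply: key' => //=.
  by rewrite gtrDl oppr_lt0 ltr01.
apply: connectedU => //; last apply: connectedU => //; last apply: connectedU => //.
- exists (r + 1, - r - 1); split; rewrite /H1 /H2 /H3 /H4 /=; last by lra.
  by left; left; lra.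
- exists (- r - 1, r + 1); split; rewrite /H1 /H2 /H3 /H4 /=; last by lra.
  by right; lra.
- by exists (r + 1, r + 1); split; rewrite /H1 /H2 /=; lra.
Qed.

(** The points having a continuum in [W] through [w0] as a neighbourhood form a clopen subset of
    [W], because a small square can be added to any continuum that it meets. Compactness then passes
    from points to [T]. *)
Lemma continuum_in_open (W T : set (R * R)) :
  open W -> connected W -> compact T -> T `<=` W ->
  exists Z, [/\ compact Z, connected Z, T `<=` Z & Z `<=` W].
Proof.
move=> oW cW cT TW.
have [->|/set0P[w0 Tw0]] := eqVneq T set0.
  by exists set0; split=> //; [exact: compact0|exact: connected0].
pose ZZ : set (set (R * R)) :=
  [set Z : set (R * R) | [/\ compact Z, connected Z, Z `<=` W & Z w0]].
have boxW w : W w -> exists2 r : R, 0 < r & box w r `<=` W.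
  by move=> Ww; apply: nbhs_box; exact: open_nbhs_nbhs.
have boxc w (r : R) : connected (box w r) by apply: star_connected (@box_star _ w r).
have boxw w (r : R) : 0 < r -> box w r w.
  by move=> r0; rewrite /box/= !subrr normr0 ltW.
pose S : set (R * R) := [set w : R * R | exists2 Z : set (R * R), ZZ Z & nbhs w Z].
have oS : open S.
  rewrite openE => w [Z ZZZ nZ].
  by apply: filterS (nbhs_interior nZ) => v; exists Z.
have SW : S = W.
  apply: cW.
  - have [r r0 rW] := boxW w0 (TW _ Tw0); exists w0, (box w0 r); last exact: box_nbhs.
    by split=> //; [exact: box_compact|exact: boxw].
  - exists S => //; apply/esym/setIidPr => w [Z [_ _ ZW _] nZ].
    exact: ZW _ (nbhs_singleton nZ).
  - exists (closure S); first exact: closed_closure.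
    apply/seteqP; split=> w.
      move=> Sw; split; last exact: subset_closure.
      by have [Z [_ _ ZW _] nZ] := Sw; exact: ZW _ (nbhs_singleton nZ).
    move=> [Ww clSw]; have [r r0 rW] := boxW w Ww.
    have [v [[Z [cZ kZ ZW Zw0] nZ] bv]] := clSw _ (box_nbhs w r0).
    exists (Z `|` box w r); last by apply: filterS (box_nbhs w r0); right.
    split; last by left.
    + by apply: compactU => //; exact: box_compact.
    + by apply: connectedU => //; exists v; split=> //; exact: nbhs_singleton.
    + by move=> u [/ZW|/rW].
(* The continua are directed by inclusion: all contain [w0], so unions of two stay connected.
   Eventually along this filter they contain all of [T]. *)
pose F := filter_from ZZ (fun Z => [set Z' | ZZ Z' /\ Z `<=` Z']).
have FF : Filter F.
  apply: filter_from_filter.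
    have : S w0 by rewrite SW; exact: TW.
    by move=> [Z ZZZ _]; exists Z.
  move=> Z1 Z2 [c1 k1 W1 z1] [c2 k2 W2 z2]; exists (Z1 `|` Z2).
    split; [exact: compactU| |by rewrite subUset|by left].
    by apply: connectedU => //; exists w0.
  by move=> Z' [ZZZ]; rewrite subUset => -[].
have /compact_near_coveringP nT := cT.
have [w Tw|Z ZZZ h] := nT _ F (fun Z w => Z w) FF.
  have [Z ZZZ nZ] : S w by rewrite SW; exact: TW.
  exists (Z, [set Z' | ZZ Z' /\ Z `<=` Z']) => /=.
    by split=> //; exists Z.
  by move=> [v Z'] [/= Zv [_ ZZ']]; exact: ZZ'.
by exists Z; have [c k ZW _] := ZZZ; split=> //; apply: (h Z); split.
Qed.

(** On the intersection the two arguments differ by a multiple of 2 pi, constant there by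
    connectedness, and shifting one makes them agree. Closedness of both sets keeps the glued
    function continuous. *)
Lemma has_arg_glue (T : topologicalType) (K L : set T) (f : T -> R * R) :
  closed K -> closed L -> connected (K `&` L) ->
  has_arg K f -> has_arg L f -> has_arg (K `|` L) f.
Proof.
move=> clK clL cKL [a ca fa] [b cb fb].
have ab1 (z : T) : (K `&` L) z -> cos (a z - b z) = 1.
  move=> [Kz Lz]; have [r r0 e] := fa z Kz; have [s s0 e'] := fb z Lz.
  by have [] := polar_inj r0 s0 (etrans (esym e) e').
have [c [c1 ab]] : exists c : R, cos c = 1 /\ forall z : T, (K `&` L) z -> a z = b z + c.
  have [KL0|/set0P[z0 KLz0]] := eqVneq (K `&` L) set0.
    by exists 0; rewrite cos0; split=> // z; rewrite KL0.
  exists (a z0 - b z0); split=> [|z KLz]; first exact: ab1.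
  apply/eqP; rewrite addrC -subr_eq; apply/eqP.
  apply: (cos1_cst cKL _ ab1) => // x; apply: (@cvgB R R^o).
    exact: (continuous_subspaceW (@subIsetl _ K L) ca).
  exact: (continuous_subspaceW (@subIsetr _ K L) cb).
pose th (z : T) := if `[<K z>] then a z else b z + c.
exists th.
  apply: withinU_continuous => //.
    apply: (@subspace_eq_continuous _ _ _ a) => // z; rewrite inE => Kz.
    by suff : a z = th z by []; rewrite /th; have [] := asboolP (K z).
  apply: (@subspace_eq_continuous _ _ _ (fun z : T => b z + c)).
    move=> z; rewrite inE => Lz; suff : b z + c = th z by [].
    by rewrite /th; have [Kz|//] := asboolP (K z); rewrite ab.
  by move=> z; apply: (@cvgD R R^o); [exact: cb|exact: cvg_cst].
move=> z KLz; rewrite /th; have [Kz|Kz] := asboolP (K z); first exact: fa.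
have Lz : L z by case: KLz.
have [r r0 ->] := fb z Lz; exists r => //; apply: polar_cos1.
by rewrite opprD addrA subrr add0r cosN.
Qed.

(* Janiszewski: an open O around M but not N has boundary F = F1 u F2 with F1
   off A and F2 off B; were the complement of A u B connected, F1 and F2 could
   be joined there along a continuum Z, and arguments of (z - m)/(z - n) on
   F1 u Z and F2 u Z would glue. *)
Lemma janiszewski A B M N :
  compact A -> compact B -> connected A -> connected B ->
  closed M -> closed N -> M !=set0 -> N !=set0 -> M `&` N = set0 ->
  A `&` B = M `|` N -> ~ connected (~` (A `|` B)).
Proof.
move=> cA cB kA kB clM clN [m Mm] [n Nn] MN0 ABMN kW.
have haus : hausdorff_space (R * R)%type by exact: norm_hausdorff.
have clA : closed A by exact: compact_closed.
have clB : closed B by exact: compact_closed.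
have oW : open (~` (A `|` B)) by apply: closed_openC; exact: closedU.
have normal : normal_space (R * R)%type by exact: (@pseudometric_normal R).
have [U [V [oU oV MU NV UV0]]] := (@normal_openP R _).1 normal _ _ clM clN MN0.
have [r r0 ABr] := compact_sub_box (compactU cA cB).
have MAB : M `<=` A `&` B by rewrite ABMN; left.
have NAB : N `<=` A `&` B by rewrite ABMN; right.
(* The square makes [O] bounded; it exceeds the one around [A] and [B] by 1, so that [M] lies in its
   interior. *)
pose O := U `&` (box 0 (r + 1))°.
have oO : open O by apply: openI => //; exact: open_interior.
have r1 : 0 < r + 1 by apply: addr_gt0.
have MO : M `<=` O.
  move=> z Mz; split; first exact: MU.
  have [Az _] := MAB _ Mz; have [z1 z2] := ABr z (or_introl Az).
  apply: filterS (box_nbhs z ltr01) => w [w1 w2].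
  rewrite /box /= !subr0 in z1 z2 w1 w2 *; split.
    by rewrite -[w.1](subrK z.1) (le_trans (ler_normD _ _))// addrC lerD.
  by rewrite -[w.2](subrK z.2) (le_trans (ler_normD _ _))// addrC lerD.
have clON z : closure O z -> ~ N z.
  move=> clO Nz; have /(_ clO)[u [[Uu _] Vu]] := fun h : closure O z =>
    h V (open_nbhs_nbhs (conj oV (NV _ Nz))).
  by have : (U `&` V) u by []; rewrite UV0.
pose F := closure O `\` O.
have boxcl : closed (box 0 (r + 1)) by apply: compact_closed => //; exact: box_compact.
have clObox : closure O `<=` box 0 (r + 1).
  rewrite [X in _ `<=` X](closure_id _).1//; apply: closureS => z [_].
  exact: interior_subset.
have clF : closed F.
  rewrite /F setDE; apply: closedI; first exact: closed_closure.
  exact: open_closedC.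
have cF : compact F.
  by apply: subclosed_compact clF (@box_compact _ 0 (r + 1)) _ => z [/clObox].
have FAB0 : (F `&` A) `&` (F `&` B) = set0.
  apply/seteqP; split=> // z [[[clO Oz] Az] [_ Bz]].
  have : (A `&` B) z by []. 
  by rewrite ABMN => -[/MO//|]; exact: clON.
(* The function is 0 on the part of [F] in [A] and 1 on the part in [B]; cutting at 1/2 puts the
   overlap of [F1] and [F2] off both continua. *)
have [psi [cpsi psiA psiB _]] := urysohn_ext_itv normal
  (closedI clF clA) (closedI clF clB) FAB0 (@ltr01 R).
pose F1 := F `&` [set z | 2^-1 <= psi z]; pose F2 := F `&` [set z | psi z <= 2^-1].
have clF1 : closed F1.
  apply: closedI => //.
  by apply: (@preimage_closed _ _ psi [set x | 2^-1 <= x]) => //; exact: closed_ge.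
have clF2 : closed F2.
  apply: closedI => //.
  by apply: (@preimage_closed _ _ psi [set x | x <= 2^-1]) => //; exact: closed_le.
have F1A z : F1 z -> ~ A z.
  move=> [Fz /= h] Az; have : [set (0 : R)] (psi z) by apply: psiA; exists z.
  by move=> /= e; rewrite e in h; clear -h; lra.
have F2B z : F2 z -> ~ B z.
  move=> [Fz /= h] Bz; have : [set (1 : R)] (psi z) by apply: psiB; exists z.
  by move=> /= e; rewrite e in h; clear -h; lra.
have cF12 : compact (F1 `&` F2).
  by apply: subclosed_compact cF _; [exact: closedI|move=> z [[]]].
have F12W : F1 `&` F2 `<=` ~` (A `|` B).
  by move=> z [F1z F2z] [Az|Bz]; [exact: F1A F1z Az|exact: F2B F2z Bz].
have [Z [cZ kZ FZ ZW]] := continuum_in_open oW kW cF12 F12W.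
have clZ : closed Z by exact: compact_closed.
have cF1 : compact F1 by apply: subclosed_compact cF _ => // z [].
have cF2 : compact F2 by apply: subclosed_compact cF _ => // z [].
have [Am Bm] := MAB _ Mm; have [An Bn] := NAB _ Nn.
have a1 : has_arg (F1 `|` Z) (fun z => cmul (z - m) (conjp (z - n))).
  apply: (@has_arg_ratio _ _ A) => //; first exact: compactU.
  apply/seteqP; split=> // z [Az [/F1A//|/ZW h]].
  by apply: h; left.
have a2 : has_arg (F2 `|` Z) (fun z => cmul (z - m) (conjp (z - n))).
  apply: (@has_arg_ratio _ _ B) => //; first exact: compactU.
  apply/seteqP; split=> // z [Bz [/F2B//|/ZW h]].
  by apply: h; right.
have FZZ : (F1 `|` Z) `&` (F2 `|` Z) = Z.
  by rewrite -setUIl; apply/setUidPr.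
have := has_arg_glue (closedU clF1 clZ) (closedU clF2 clZ) _ a1 a2.
rewrite FZZ => /(_ kZ) a12.
have aF : has_arg F (fun z => cmul (z - m) (conjp (z - n))).
  apply: has_argW a12 => z Fz; have [h|h] := leP 2^-1 (psi z).
    by left; left.
  by right; left; split=> //; exact: ltW.
apply: (@surround_no_arg _ O F m n (2 * (r + 1))) aF => //.
- move=> z /subset_closure/clObox[z1 z2].
  have [] := clObox m (subset_closure (MO _ Mm)).
  rewrite /box /= !subr0 in z1 z2 * => m1 m2.
  by split; rewrite (le_trans (ler_normB _ _))// mulrC mulr_natr mulr2n lerD.
- by move=> z clz; have [Oz|Oz] := pselect (O z); [left|right].
- exact: MO.
- by move=> /subset_closure/clON; exact.
- by move=> [/clON + _]; exact.
Qed.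

(** One side of a separation of the complement of [A] and [B] must lie in [D]. Otherwise both sides
    have a point off [D], while one side [E b] misses the exterior of a large square. What remains
    of [E b] outside [D] is then a bounded open set with frontier in [D], and a quotient map built
    from the two points has no argument on [D]. *)
Lemma janiszewski_component D A B M N :
  compact D ->
  (forall f : R * R -> R * R, {within D, continuous f} ->
    (forall z, D z -> f z != 0) -> has_arg D f) ->
  compact A -> compact B -> connected A -> connected B ->
  A `<=` D -> B `<=` D ->
  closed M -> closed N -> M !=set0 -> N !=set0 -> M `&` N = set0 ->
  A `&` B = M `|` N ->
  exists O, [/\ open O, O !=set0, O `<=` D, O `<=` ~` (A `|` B) &
    closure O `<=` O `|` (A `|` B)].
Proof.
move=> cD liftD cA cB kA kB AD BD clM clN M0 N0 MN0 ABMN.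
have haus : hausdorff_space (R * R)%type by exact: norm_hausdorff.
have oW : open (~` (A `|` B)).
  by apply: closed_openC; apply: closedU; exact: compact_closed.
have /connectedPn[E [E0 WE [sE1 sE2]]] :=
  janiszewski cA cB kA kB clM clN M0 N0 MN0 ABMN.
have EW b : E b `<=` ~` (A `|` B) by rewrite WE; case: b => z Ez; [right|left].
have clE b z : closure (E b) z -> ~ E (~~ b) z.
  move=> clEz Ez; case: b clEz Ez => /= h1 h2.
    by have : (E false `&` closure (E true)) z by []; rewrite sE2.
  by have : (closure (E false) `&` E true) z by []; rewrite sE1.
have EWb b z : (~` (A `|` B)) z -> ~ E (~~ b) z -> E b z.
  by rewrite WE; case: b => -[].
have oE b : open (E b).
  have -> : E b = ~` (A `|` B) `&` ~` closure (E (~~ b)).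
    apply/seteqP; split=> z.
      by move=> Ez; split; [exact: EW Ez|move=> /clE; rewrite negbK].
    by move=> [Wz nE]; apply: EWb => // Ez; apply: nE; exact: subset_closure.
  by apply: openI => //; exact/closed_openC/closed_closure.
have done1 b : E b `<=` D -> exists O, [/\ open O, O !=set0, O `<=` D,
    O `<=` ~` (A `|` B) & closure O `<=` O `|` (A `|` B)].
  move=> ED; exists (E b); split; [exact: oE|exact: E0|exact: ED|exact: (EW b)|].
  move=> z clz; have [|Wz] := pselect ((A `|` B) z); first by right.
  by left; apply: EWb => //; exact: clE.
have [|E0D] := pselect (E false `<=` D); first exact: done1.
have [|E1D] := pselect (E true `<=` D); first exact: done1.
have [r r0 Dr] := compact_sub_box cD.
have DAB z : ~ D z -> (~` (A `|` B)) z by move=> Dz [/AD|/BD].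
have clD : closed D by exact: compact_closed.
exfalso.
suff key b : ~` box 0 r `<=` E (~~ b) -> False.
  have [] := @connected_subset _ (E false) (E true) (~` box 0 r) (conj sE1 sE2) _
    (@exterior_connected r).
  - by rewrite -WE => z zr; apply: DAB => /Dr.
  - exact: (key true).
  - exact: (key false).
move=> rE.
have [m [Em Dm]] : exists z, E b z /\ ~ D z.
  by case: b {rE}; [move/existsNP: E1D|move/existsNP: E0D] => -[z /not_implyP]; exists z.
have [n [En Dn]] : exists z, E (~~ b) z /\ ~ D z.
  by case: b {rE Em}; [move/existsNP: E0D|move/existsNP: E1D] => -[z /not_implyP]; exists z.
have Er z : E b z -> box 0 r z.
  move=> Ez; apply: contrapT => /rE; apply: clE; exact: subset_closure.
apply: (@surround_no_arg _ (E b `\` D) D m n (2 * r)) => //.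
- by rewrite setDE; apply: openI => //; exact: closed_openC.
- move=> z [/Er[z1 z2] _]; have [] := Er m Em.
  rewrite /box /= !subr0 in z1 z2 * => m1 m2.
  by split; rewrite (le_trans (ler_normB _ _))// mulrC mulr_natr mulr2n lerD.
- move=> z clz; have [|Dz] := pselect (D z); first by right.
  left; split=> //; apply: EWb; first exact: DAB.
  by apply: clE; apply: closureS clz => u [].
- by move=> [En' _]; exact: clE (subset_closure En') En.
- apply: liftD.
    apply: continuous_subspaceT => z; apply: cvg_cmul.
      by apply: (@cvgB R (R * R)%type); [exact: cvg_id|exact: cvg_cst].
    apply: cvg_conjp.
    by apply: (@cvgB R (R * R)%type); [exact: cvg_id|exact: cvg_cst].
  move=> z Dz; have zm : z - m != 0.
    by rewrite subr_eq0; apply/eqP => e; apply: Dm; rewrite -e.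
  have zn : z - n != 0.
    by rewrite subr_eq0; apply/eqP => e; apply: Dn; rewrite -e.
  have [a a0 [al ->]] := polar_ex zm; have [b' b0 [be ->]] := polar_ex zn.
  rewrite (_ : cmul _ _ = polar (a * b') (al - be)) ?polar_neq0 ?mulr_gt0//.
  by rewrite /cmul /conjp /polar /= cosB sinB; congr (_, _); ring.
Qed.

End PlaneSeparation.

(** * From the plane to the surface *)

Section Transport.
Context {R : realType}.
Implicit Types (T : topologicalType).

(* For compact D this says that the first Cech cohomology of D vanishes. *)
Definition liftable T (D : set T) := forall f : T -> R * R,
  {within D, continuous f} -> (forall x, D x -> f x != 0) -> has_arg D f.

(** Replaces a homeomorphism of subspaces by total maps inverse to each other on [A] and [B]; [a0]
    and [b0] are the values taken elsewhere. *)
Lemma homeomorphic_sets (T T' : topologicalType) (A : set T) (B : set T')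
    (a0 : T) (b0 : T') : homeomorphic (set_type A) (set_type B) ->
  exists (h : T -> T') (k : T' -> T),
    [/\ {within A, continuous h}, {within B, continuous k},
       forall x, A x -> B (h x) /\ k (h x) = x &
       forall y, B y -> A (k y) /\ h (k y) = y].
Proof.
move=> [f [g [fK gK cf cg]]].
pose h := valL_ b0 (set_val \o f : A -> T').
pose k := valL_ a0 (set_val \o g : B -> T).
have hE (u : A) : h (set_val u) = set_val (f u).
  by have := congr1 (fun F => F u) (valLK b0 (set_val \o f : A -> T')).
have kE (u : B) : k (set_val u) = set_val (g u).
  by have := congr1 (fun F => F u) (valLK a0 (set_val \o g : B -> T)).
exists h, k; split.
- apply/subspace_sigL_continuousP; rewrite valLK => u.
  by apply: continuous_comp; [exact: cf|exact: initial_continuous].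
- apply/subspace_sigL_continuousP; rewrite valLK => u.
  by apply: continuous_comp; [exact: cg|exact: initial_continuous].
- move=> x Ax; pose u : A := exist _ x (mem_set Ax).
  have -> : x = set_val u by [].
  by rewrite hE; split; [exact: set_valP|rewrite kE fK].
- move=> x Bx; pose u : B := exist _ x (mem_set Bx).
  have -> : x = set_val u by [].
  by rewrite kE; split; [exact: set_valP|rewrite hE gK].
Qed.

Lemma liftable_homeo (T T' : topologicalType) (D : set T) (E : set T')
    (h : T -> T') (k : T' -> T) :
  {within D, continuous h} -> {within E, continuous k} ->
  (forall x, D x -> E (h x) /\ k (h x) = x) -> (forall y, E y -> D (k y)) ->
  liftable E -> liftable D.
Proof.
move=> ch ck hk kD liftE f cf f0.
have [|y Ey|th cth fth] := liftE (f \o k).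
  exact: (within_comp kD ck cf).
exact: (f0 _ (kD _ Ey)).
exists (th \o h).
  by apply: (within_comp _ ch cth) => x /hk[].
move=> x Dx; have [Ehx khx] := hk x Dx; have [r r0] := fth _ Ehx.
by rewrite /= khx; exists r.
Qed.

Lemma liftable_star (c : R * R) (K : set (R * R)) :
  compact K -> star_shaped c K -> liftable K.
Proof. by move=> cK sK f cf f0; exact: has_arg_star cK sK cf f0. Qed.

Lemma compact_closed_unit_disc : compact (@closed_unit_disc R).
Proof.
have sub : @closed_unit_disc R `<=` box 0 1.
  move=> z; rewrite /closed_unit_disc /box /= !subr0 => h.
  by split; rewrite ler_norml; nra.
apply: (subclosed_compact _ (@box_compact R 0 1) sub).
apply: (@preimage_closed _ _ nsq [set x : R | x <= 1]); last exact: closed_le.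
by move=> z _; apply: (@cvgD R R^o); apply: (@cvgM R); (exact: cvg_fst || exact: cvg_snd).
Qed.

Lemma star_closed_unit_disc : star_shaped 0 (@closed_unit_disc R).
Proof.
move=> z; rewrite /closed_unit_disc /segm /= => h t /andP[t0 t1].
by rewrite !subr0 !add0r !exprMn; nra.
Qed.

Lemma closed_disc_liftable T (D : set T) : closed_disc R D -> liftable D.
Proof.
move=> hD; have [f [g _]] := hD.
have d0 : @closed_unit_disc R 0 by rewrite /closed_unit_disc /= expr0n addr0 ler01.
pose u : set_type (@closed_unit_disc R) := exist _ 0 (mem_set d0).
have [h [k [ch ck hk kh]]] := @homeomorphic_sets _ _ D (@closed_unit_disc R) (set_val (g u)) 0 hD.
apply: (liftable_homeo ch ck hk) => [y /kh[]//|].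
exact: liftable_star compact_closed_unit_disc star_closed_unit_disc.
Qed.

Lemma simple_closed_curve_arcs T (C : set T) : simple_closed_curve R C ->
  exists A B (p q : T), [/\ compact A, compact B, connected A & connected B] /\
    [/\ A `<=` C, B `<=` C, A `&` B = [set p; q] & p != q].
Proof.
move=> hC; have [f [g _]] := hC.
have e1 (t : R) : unit_circle (polar 1 t).
  by rewrite /unit_circle /= !mul1r cos2Dsin2.
pose u : set_type (@unit_circle R) := exist _ (polar 1 0) (mem_set (e1 0)).
have [h [k [ch ck hk kh]]] := @homeomorphic_sets _ _ C (@unit_circle R) (set_val (g u)) 0 hC.
have cp : continuous (fun t : R => k (polar 1 t)).
  apply/continuous_subspace_setT; apply: (within_comp (B := @unit_circle R) _ _ ck) => //.
  apply: continuous_subspaceT => t; apply: cvg_pairP; apply: (@cvgM R); try exact: cvg_cst.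
    exact: continuous_cos.
  exact: continuous_sin.
have kinj s t : k (polar 1 s) = k (polar 1 t) -> polar 1 s = polar 1 t.
  by move=> e; rewrite -(kh _ (e1 s)).2 e (kh _ (e1 t)).2.
(* Upper and lower half circle as images of angle intervals. They meet at the angles 0 and [pi], the
   latter being the same point as [- pi]. *)
exists [set k (polar 1 t) | t in `[0, pi]%classic],
  [set k (polar 1 t) | t in `[- pi, 0]%classic], (k (polar 1 0)), (k (polar 1 pi)).
split; split.
- by apply: continuous_compact; [exact: continuous_subspaceT|exact: segment_compact].
- by apply: continuous_compact; [exact: continuous_subspaceT|exact: segment_compact].
- by apply: connected_continuous_connected; [exact: segment_connected|exact: continuous_subspaceT].
- by apply: connected_continuous_connected; [exact: segment_connected|exact: continuous_subspaceT].
- by move=> _ [t _ <-]; exact: (kh _ (e1 t)).1.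
- by move=> _ [t _ <-]; exact: (kh _ (e1 t)).1.
- apply/seteqP; split=> x.
    move=> [[s]]; rewrite /= in_itv /= => s01 <- [t]; rewrite /= in_itv /= => t01 /kinj ts.
    have [_ sts] := ts; rewrite !mul1r in sts.
    (* The common sine is nonnegative for the upper angle and nonpositive for the lower one. *)
    have s0 : sin s = 0.
      apply/eqP; rewrite eq_le sin_ge0_pi// andbT -sts -oppr_ge0 -sinN sin_ge0_pi//.
      by move: t01; rewrite oppr_ge0 lerNl andbC.
    have /eqP := sin0cos1 s0; rewrite eqr_norml ler01 andbT => /orP[]/eqP c.
      by left; rewrite /polar c s0 cos0 sin0.
    by right; rewrite /polar c s0 cospi sinpi.
  move=> [->|->]; split.
  + by exists 0 => //=; rewrite in_itv/= lexx pi_ge0.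
  + by exists 0 => //=; rewrite in_itv/= lexx oppr_le0 pi_ge0.
  + by exists pi => //=; rewrite in_itv/= lexx pi_ge0.
  + exists (- pi) => /=; first by rewrite in_itv/= lexx oppr_le0 pi_ge0.
    by rewrite /polar cosN sinN sinpi oppr0.
- apply/eqP => /kinj[]; rewrite !mul1r cos0 cospi => e _.
  by lra.
Qed.

(** [liftable D] crosses the chart and stands in for any knowledge of how the image of [D] lies in
    the plane. *)
Lemma chart_component (S : topologicalType) (U : set S) (V : set (R * R))
    (phi : S -> R * R) (psi : R * R -> S) (D A B M N : set S) :
  hausdorff_space S -> open U ->
  {within U, continuous phi} -> {within V, continuous psi} ->
  (forall x, U x -> V (phi x) /\ psi (phi x) = x) ->
  (forall z, V z -> U (psi z) /\ phi (psi z) = z) ->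
  D `<=` U -> compact D -> liftable D ->
  compact A -> compact B -> connected A -> connected B ->
  A `<=` D -> B `<=` D ->
  closed M -> closed N -> M !=set0 -> N !=set0 -> M `&` N = set0 ->
  A `&` B = M `|` N ->
  exists O, [/\ open O, O !=set0, O `<=` D, O `<=` ~` (A `|` B) &
    closure O `<=` O `|` (A `|` B)].
Proof.
move=> hS oU cphi cpsi UV VU DU cD liftD cA cB kA kB AD BD clM clN M0 N0 MN0 ABMN.
have haus : hausdorff_space (R * R)%type by exact: norm_hausdorff.
have phiW X : X `<=` D -> {within X, continuous phi}.
  by move=> XD; apply: (continuous_subspaceW _ cphi); exact: subset_trans DU.
have phiinj x y : D x -> D y -> phi x = phi y -> x = y.
  by move=> /DU/UV[_ ex] /DU/UV[_ ey] e; rewrite -ex e ey.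
have cphiX X : X `<=` D -> compact X -> compact (phi @` X).
  by move=> XD cX; apply: continuous_compact cX; exact: phiW.
have sub X Y : X `<=` Y -> phi @` X `<=` phi @` Y := @image_subset _ _ phi X Y.
have AB X : X `<=` A `&` B -> closed X -> compact X.
  by move=> XAB clX; apply: (subclosed_compact clX cA) => x /XAB[].
have MAB : M `<=` A `&` B by rewrite ABMN; left.
have NAB : N `<=` A `&` B by rewrite ABMN; right.
have ABD : A `&` B `<=` D by move=> x [/AD].
have phiI X Y : X `<=` D -> Y `<=` D -> phi @` X `&` phi @` Y = phi @` (X `&` Y).
  move=> XD YD; apply/seteqP; split=> [_ [[x Xx <-] [y Yy e]]|_ [x [Xx Yx] <-]].
    by exists x => //; split=> //; rewrite (phiinj x y) //; [exact: XD|exact: YD].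
  by split; exists x.
have [] := @janiszewski_component R (phi @` D) (phi @` A) (phi @` B) (phi @` M) (phi @` N).
- exact: cphiX.
- apply: (@liftable_homeo _ _ _ D psi phi) => //.
  + by apply: (continuous_subspaceW _ cpsi) => _ [x /DU/UV[? _] <-].
  + exact: phiW.
  + by move=> _ [x Dx <-]; have [_ ->] := UV x (DU x Dx).
- exact: cphiX.
- exact: cphiX.
- by apply: connected_continuous_connected kA _; exact: phiW.
- by apply: connected_continuous_connected kB _; exact: phiW.
- exact: sub.
- exact: sub.
- apply: compact_closed haus _; apply: cphiX; last exact: AB.
  exact: subset_trans ABD.
- apply: compact_closed haus _; apply: cphiX; last exact: AB.
  exact: subset_trans ABD.
- by case: M0 => x Mx; exists (phi x), x.
- by case: N0 => x Mx; exists (phi x), x.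
- rewrite phiI ?MN0 ?image_set0//; exact: subset_trans ABD.
- by rewrite phiI// ABMN image_setU.
move=> O' [oO' [_z] O'z O'D O'AB clO'].
have OE x : U x -> O' (phi x) -> D x.
  by move=> Ux /O'D[y Dy e]; rewrite -(UV x Ux).2 -e (UV y (DU y Dy)).2.
have cphiU x : U x -> {for x, continuous phi}.
  move=> Ux; move: cphi; rewrite continuous_open_subspace// => /(_ x); apply.
  by rewrite inE.
exists (U `&` phi @^-1` O'); split.
- rewrite openE => x [Ux Ox]; rewrite /interior; apply: filterI.
    exact: open_nbhs_nbhs.
  by apply: cphiU => //; exact: open_nbhs_nbhs.
- have [y Dy e] := O'D _ O'z; exists y; split; first exact: DU.
  by rewrite /= e.
- by move=> x [Ux Ox]; exact: OE.
- by move=> x [Ux Ox] [Ax|Bx]; apply: (O'AB _ Ox); [left|right]; exists x.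
- move=> x clx; have Dx : D x.
    have : closed D by exact: compact_closed.
    by apply; apply: closureS clx => y [Uy Oy]; exact: OE.
  have Ux := DU x Dx.
  have /clO'[Ox|[[y Ay e]|[y By e]]] : closure O' (phi x).
    move=> W /(cphiU x Ux) nW; have [y [[Uy Oy] Wy]] := clx _ nW.
    by exists (phi y).
  - by left.
  - by right; left; rewrite -(phiinj y x)//; exact: AD.
  - by right; right; rewrite -(phiinj y x)//; exact: BD.
Qed.

End Transport.

(** * Compact spaces, subspaces and quotients *)

Section CompactSpaces.
Context {R : realType}.

Lemma separated_closed (T : topologicalType) (K : set T) (E : bool -> set T) b :
  closed K -> K = E false `|` E true -> separated (E false) (E true) ->
  closed (E b).
Proof.
move=> clK KE [sE1 sE2] y clEy; have Ky : K y.
  by apply: clK; apply: closureS clEy => z Ez; rewrite KE; case: b Ez; [right|left].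
move: Ky; rewrite KE => -[] Ey; case: b clEy => // clEy.
  by have : (E false `&` closure (E true)) y by []; rewrite sE2.
by have : (closure (E false) `&` E true) y by []; rewrite sE1.
Qed.

(** If every member left [G], the differences with [G] would generate a proper filter, and a cluster
    point would lie in all members yet outside [G]. *)
Lemma directed_compact (T : topologicalType) (X G : set T) (HH : set (set T)) :
  compact X -> open G -> HH !=set0 ->
  (forall H, HH H -> closed H /\ H `<=` X) ->
  (forall H H', HH H -> HH H' -> HH (H `&` H')) ->
  (forall x, (forall H, HH H -> H x) -> G x) ->
  exists2 H, HH H & H `<=` G.
Proof.
move=> cX oG [H0 HH0] clH HI capG; apply: contrapT => nG.
pose F := filter_from HH (fun H => H `\` G).
have FF : ProperFilter F.
  apply: filter_from_proper.
    apply: filter_from_filter; first by exists H0.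
    by move=> H H' h h'; exists (H `&` H'); [exact: HI|move=> x [[]]].
  move=> H h; apply/set0P/eqP => HG; apply: nG; exists H => //.
  by move=> x Hx; apply: contrapT => Gx; have : (H `\` G) x by []; rewrite HG.
have [|p [Xp clp]] := cX F FF.
  by exists H0 => // x [/(clH _ HH0).2].
have pH H : HH H -> (H `\` G) p.
  move=> h; have [clH' _] := clH H h.
  have : closed (H `\` G) by rewrite setDE; apply: closedI => //; exact: open_closedC.
  by apply; move=> W nW; apply: clp => //; exists H.
by have [_] := pH _ HH0; apply; apply: capG => H /pH[].
Qed.

(** Components and quasicomponents agree in a compact Hausdorff space. A separation of the
    quasicomponent [K] thickens to disjoint open sets by normality. These cover some relatively
    clopen [H], whose part on the side of [x] is relatively clopen again, so [K] misses the other
    side. *)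
Lemma component_clopen (T : pseudoMetricType R) (X G : set T) x :
  hausdorff_space T -> compact X -> X x -> open G ->
  connected_component X x `<=` G ->
  exists H, [/\ closed H, closed (X `\` H), H `<=` X, H x & H `<=` G].
Proof.
move=> hT cX Xx oG CG; have clX := compact_closed hT cX.
pose HH := [set H : set T | [/\ closed H, closed (X `\` H), H `<=` X & H x]].
have HHX : HH X by split=> //; rewrite setDv; exact: closed0.
have HHI H H' : HH H -> HH H' -> HH (H `&` H').
  move=> [c1 d1 s1 x1] [c2 d2 s2 x2]; split=> //.
  - exact: closedI.
  - by rewrite setDIr; exact: closedU.
  - by move=> y [/s1].
have HHcl H : HH H -> closed H /\ H `<=` X by case.
pose K := [set y | forall H, HH H -> H y].
have clK : closed K.
  have -> : K = \bigcap_(H in HH) H by apply/seteqP; split=> y.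
  by apply: closed_bigI => H [].
have Kx : K x by move=> H [].
have kK : connected K.
  apply: contrapT => /connectedPn[E [E0 KE sE]]; have [sE1 _] := sE.
  have clE b : closed (E b) by exact: separated_closed clK KE sE.
  have EE0 : E false `&` E true = set0.
    by apply/seteqP; split=> // y [y1 y2]; rewrite -sE1; split=> //; exact: subset_closure.
  have := (@normal_openP R _).1 (@pseudometric_normal R T) _ _ (clE false) (clE true) EE0.
  move=> [U0 [U1 [oU0 oU1 EU0 EU1 U01]]].
  pose U b := if b then U1 else U0.
  have oU b : open (U b) by case: b.
  have EU b : E b `<=` U b by case: b.
  have UU b y : U b y -> U (~~ b) y -> False.
    by case: b => /= h1 h2; have : (U0 `&` U1) y by []; rewrite U01.
  have [|H HHH HU] := @directed_compact T X (U false `|` U true) HH cX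
      (openU oU0 oU1) (ex_intro _ X HHX) HHcl HHI.
    by move=> y Ky; have : K y by []; rewrite KE => -[/EU0|/EU1]; [left|right].
  have [b Ebx] : exists b, E b x by move: Kx; rewrite KE => -[]; eexists; eassumption.
  have HbE : H `&` U b = H `\` U (~~ b).
    apply/seteqP; split=> y [Hy Uy]; split=> //; first by move=> /UU; apply; rewrite ?negbK.
    by case: b Uy {Ebx} => /=; case: (HU y Hy).
  have HHb : HH (H `&` U b).
    have [c d s Hx] := HHH; split.
    - by rewrite HbE setDE; apply: closedI => //; exact: open_closedC.
    - rewrite setDIr; apply: closedU => //.
      have -> : X `\` U b = X `&` ~` U b by rewrite setDE.
      by apply: closedI => //; exact: open_closedC.
    - by move=> y [/s].
    - by split=> //; exact: EU.
  have [y Ey] := E0 (~~ b).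
  have Ky : K y by rewrite KE; case: (b) Ey; [left|right].
  by have [_ Uy] := Ky _ HHb; apply: (UU b y) => //; exact: EU.
have KX : K `<=` X by move=> y /(_ X HHX).
have [|H [c d s Hx] HG] := @directed_compact T X G HH cX oG (ex_intro _ X HHX) HHcl HHI.
  by move=> y Ky; apply: CG; exact: (connected_component_max Kx KX kK).
by exists H.
Qed.

(** A component of the part of [K] in [D] that stays in the interior of [D] is enclosed in a
    relatively clopen [H] still in that interior; such an [H] is clopen in all of [K], hence equals
    [K]. *)
Lemma boundary_bumping (T : pseudoMetricType R) (K D : set T) x :
  hausdorff_space T -> compact K -> connected K -> closed D -> K x -> D x ->
  connected_component (K `&` D) x `<=` D° -> K `<=` D.
Proof.
move=> hT cK kK clD Kx Dx CD; have clK := compact_closed hT cK.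
have cX : compact (K `&` D).
  by apply: (subclosed_compact _ cK) => [|y []//]; exact: closedI.
have [H [clH clXH HX Hx HD]] :=
  component_clopen hT cX (conj Kx Dx) (open_interior D) CD.
suff HK : H = K by move=> y; rewrite -HK => /HX[].
apply: kK; first by exists x.
- exists (~` ((K `&` D) `\` H `|` ~` D°)).
    by apply: closed_openC; apply: closedU => //; apply: open_closedC; exact: open_interior.
  apply/seteqP; split=> y.
    move=> Hy; split; first by case: (HX _ Hy).
    by move=> [[_]|]; apply=> //; exact: HD.
  move=> [Ky /not_orP[nH /contrapT Dy]]; apply: contrapT => Hy; apply: nH.
  by split=> //; split=> //; exact: interior_subset Dy.
- by exists H => //; apply/esym/setIidPr => y /HX[].
Qed.

(** Nonempty open sets are chosen with nested closures that avoid one [closure (F n)] after the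
    other; compactness gives a point common to all. *)
Lemma baire_compact (T : pseudoMetricType R) (O : set T) (F : nat -> set T) :
  compact [set: T] -> open O -> O !=set0 -> (forall n, nowhere_dense (F n)) ->
  ~ O `<=` \bigcup_n F n.
Proof.
move=> cT oO O0 ndF OF.
pose P (V : set T) := open V /\ V !=set0.
have step n (V : {V | P V}) :
    {V' : {V | P V} | closure (sval V') `<=` sval V `\` closure (F n)}.
  apply: cid; case: V => V [oV V0] /=.
  have oVF : open (V `\` closure (F n)).
    by rewrite setDE; apply: openI => //; exact/closed_openC/closed_closure.
  have [x Vx] : V `\` closure (F n) !=set0.
    apply/set0P/eqP => VF; case: V0 => x Vx.
    have : interior (closure (F n)) x.
      apply: (filterS _ (open_nbhs_nbhs (conj oV Vx))) => y Vy.
      by apply: contrapT => nFy; have : (V `\` closure (F n)) y by []; rewrite VF.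
    by rewrite ndF.
  have [B nB BV] := @uniform_regular T x _ (open_nbhs_nbhs (conj oVF Vx)).
  have PB : P B° by split; [exact: open_interior|exists x; exact: nB].
  exists (exist _ _ PB) => /=; apply: subset_trans BV; apply: closureS.
  exact: interior_subset.
pose V := fix V n : {V | P V} :=
  if n is m.+1 then sval (step m (V m)) else exist _ O (conj oO O0).
have VS n : closure (sval (V n.+1)) `<=` sval (V n) `\` closure (F n).
  by rewrite /=; case: (step n (V n)).
have V0 n : sval (V n) !=set0 by case: (V n) => ? [].
have Vle n m : sval (V (n + m)%N) `<=` sval (V n).
  elim: m => [|m IH]; first by rewrite addn0.
  by rewrite addnS => x /subset_closure/VS[/IH].
pose FF := filter_from [set: nat] (fun n => sval (V n)).
have pFF : ProperFilter FF.
  apply: filter_from_proper => //; apply: filter_from_filter; first by exists 0%N.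
  move=> i j _ _; exists (i + j)%N => // x Vx; split; first exact: Vle Vx.
  by rewrite addnC in Vx; exact: Vle Vx.
have [|p [_ clp]] := cT FF pFF; first by exists 0%N.
have clVp n : closure (sval (V n)) p by move=> W nW; apply: clp => //; exists n.
have Op : O p by have [] := VS 0%N p (clVp 1%N).
have [n _ Fp] := OF p Op.
by have [_] := VS n p (clVp n.+1); apply; exact: subset_closure.
Qed.

End CompactSpaces.

(** * Connectedness, local connectedness and metrics of subspaces *)

Section Subspaces.
Context {R : realType}.
Implicit Types T : topologicalType.

Lemma nbhs_set_typeP T (A : set T) (u : set_type A) (U : set (set_type A)) :
  nbhs u U <-> exists2 W, nbhs (set_val u) W & set_val @^-1` W `<=` U.
Proof.
split=> [[_ [[W oW <-] /= Wu WU]]|[W nW WU]].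
  by exists W => //; exact: open_nbhs_nbhs.
exists (set_val @^-1` W°); split=> /=.
- by exists W° => //; exact: open_interior.
- exact: nW.
- by move=> v /= /interior_subset; exact: WU.
Qed.

Lemma set_type_connected T (A : set T) (B : set (set_type A)) :
  connected (set_val @` B) -> connected B.
Proof.
move=> kB X [x0 Xx0] [_ [C oC <-] XC] [D clD XD].
have [E oE DE] : open (~` D) by exact: closed_openC.
have XB : X `<=` B by rewrite XC; exact: subIsetl.
suff e : set_val @` X = set_val @` B.
  apply/seteqP; split=> // y By; have : (set_val @` X) (set_val y) by rewrite e; exists y.
  by move=> [z Xz zy]; rewrite -(val_inj zy).
apply: kB; first by exists (set_val x0), x0.
- exists C => //; apply/seteqP; split=> [_ [x + <-]|_ [[x Bx <-] Cx]].
    by rewrite XC => -[Bx Cx]; split=> //; exists x.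
  by exists x => //; rewrite XC.
- exists (~` E); first exact: open_closedC.
  apply/seteqP; split=> [_ [x + <-]|_ [[x Bx <-] Ex]].
    rewrite XD => -[Bx Dx]; split; first by exists x.
    by move=> Ex; have : (~` D) x by rewrite -DE.
  exists x => //; rewrite XD; split=> //.
  by apply: contrapT => Dx; apply: Ex; have : (~` D) x by []; rewrite -DE.
Qed.

Lemma set_type_compact T (A : set T) (B : set (set_type A)) :
  compact (set_val @` B) -> compact B.
Proof.
move=> cB F FF FB.
have FX (X : set (set_type A)) : F X -> F (set_val @^-1` (set_val @` X)).
  by move=> FX; apply: filterS FX => x Xx; exists x.
have [|p [[b Bb <-] clp]] := cB (set_val @ F) _; first exact: FX.
exists b; split=> // X U /FX FX' /nbhs_set_typeP[W nW WU].
have [_ [[x Xx <-] Wx]] := clp (set_val @` X) W FX' nW.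
by exists x; split=> //; exact: WU.
Qed.

Lemma set_val_imageT T (A : set T) : set_val @` [set: set_type A] = A.
Proof.
apply/seteqP; split=> [_ [x _ <-]|x Ax]; first exact: set_valP.
by exists (exist _ x (mem_set Ax)).
Qed.

Lemma set_val_image_preimage T (A B : set T) : B `<=` A ->
  set_val @` (set_val @^-1` B : set (set_type A)) = B.
Proof.
move=> BA; apply/seteqP; split=> [_ [x Bx <-]//|x Bx].
by exists (exist _ x (mem_set (BA _ Bx))).
Qed.

(** Connected neighbourhoods that need not be open suffice when every point has them: they make the
    components of open sets open. *)
Lemma im_kleinen_locally_connected T (A : set T) :
  (forall x W, A x -> nbhs x W -> exists V,
    [/\ connected V, V `<=` A `&` W, V x & \forall y \near x, A y -> V y]) ->
  locally_connected (set_type A).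
Proof.
move=> ikA u W /nbhs_set_typeP[W1 nW1 W1W].
pose X : set (set_type A) := set_val @^-1` W1°.
have Xu : X u by exact: nW1.
exists (connected_component X u); split.
- rewrite openE => v Cv; have Xv := connected_component_sub Cv.
  have [V [kV VAW Vv nV]] := ikA (set_val v) W1° (set_valP v) (nbhs_interior Xv).
  apply/nbhs_set_typeP; exists [set y | A y -> V y] => // w /(_ (set_valP w)) Vw.
  have /same_connected_component-> := Cv.
  apply: (@connected_component_max _ X (set_val @^-1` V) v) => //.
    by move=> z /VAW[].
  by apply: set_type_connected; rewrite set_val_image_preimage// => y /VAW[].
- exact: connected_component_refl.
- exact: component_connected.
- by move=> v /connected_component_sub/interior_subset/W1W.
Qed.

Lemma locally_connected_im_kleinen T (A : set T) x W :
  locally_connected (set_type A) -> A x -> nbhs x W -> exists V,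
    [/\ connected V, V `<=` A `&` W, V x & \forall y \near x, A y -> V y].
Proof.
move=> lcA Ax nW; pose u : set_type A := exist _ x (mem_set Ax).
have [|V [oV Vu kV VW]] := lcA u (set_val @^-1` W).
  by apply/nbhs_set_typeP; exists W.
exists (set_val @` V); split.
- apply: connected_continuous_connected => //.
  by apply: continuous_subspaceT; exact: initial_continuous.
- by move=> _ [v Vv <-]; split; [exact: set_valP|exact: VW].
- by exists u.
- have /nbhs_set_typeP[W' nW' W'V] := open_nbhs_nbhs (conj oV Vu).
  apply: filterS nW' => y W'y Ay.
  by exists (exist _ y (mem_set Ay)) => //; exact: W'V.
Qed.

Lemma homeomorphic_locally_connected (T U : topologicalType) :
  homeomorphic T U -> locally_connected U -> locally_connected T.
Proof.
move=> [f [g [fK gK cf cg]]] lcU x W nW.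
have [|V [oV Vx kV VW]] := lcU (f x) (g @^-1` W).
  by apply: cg; rewrite fK.
exists (g @` V); split.
- have -> : g @` V = f @^-1` V.
    apply/seteqP; split=> [_ [y Vy <-]|y Vy]; first by rewrite /= gK.
    by exists (f y).
  by apply: open_comp => // y _; exact: cf.
- by exists (f x).
- by apply: connected_continuous_connected => //; exact: continuous_subspaceT.
- by move=> _ [y /VW Wy <-].
Qed.

Lemma closed_disc_locally_connected T (D : set T) :
  closed_disc R D -> locally_connected (set_type D).
Proof.
move=> hD; apply: homeomorphic_locally_connected hD _.
apply: im_kleinen_locally_connected => z W Dz /nbhs_box[r r0 rW].
exists (closed_unit_disc (R:=R) `&` box z r); split.
- apply: (@star_connected _ z) => w [Dw bw] t t01; split; last exact: box_star.
  move: t01 Dz Dw => /andP[t0 t1]; rewrite /closed_unit_disc /segm /= => h1 h2.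
  set a := z.1 in h1 *; set b := z.2 in h1 *.
  set c := w.1 in h2 *; set d := w.2 in h2 *.
  (* Convexity of the squared norm, with its defect term written out. *)
  have -> : (a + t * (c - a)) ^+ 2 + (b + t * (d - b)) ^+ 2 =
    (1 - t) * (a ^+ 2 + b ^+ 2) + t * (c ^+ 2 + d ^+ 2)
    - t * (1 - t) * ((c - a) ^+ 2 + (d - b) ^+ 2) by ring.
  have := sqr_ge0 (c - a); have := sqr_ge0 (d - b).
  move: (c ^+ 2 + _) h2 (a ^+ 2 + _) h1 ((c - a) ^+ 2) ((d - b) ^+ 2) => p p1 q q1 u v v0 u0.
  have : 0 <= t * (1 - t) * (u + v).
    by apply: mulr_ge0; [apply: mulr_ge0 => //; rewrite subr_ge0|exact: addr_ge0].
  by nra.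
- by move=> w [Dw /rW].
- by split=> //; rewrite /box/= !subrr normr0 ltW.
- by apply: filterS (box_nbhs z r0).
Qed.

Record is_dist (T : Type) (d : T -> T -> R) := IsDist {
  is_distxx : forall x, d x x = 0;
  is_dist_pos : forall x y, d x y = 0 -> x = y;
  is_dist_sym : forall x y, d x y = d y x;
  is_dist_triangle : forall y x z, d x z <= d x y + d y z }.

(** A copy of [T] that carries the topology of [d] and leaves that of [T] untouched; the parameter
    [hd] lets the metric structure be inferred from the type. *)
Definition dist_space (T : topologicalType) (d : T -> T -> R) (hd : is_dist d) : Type := T.

HB.instance Definition _ (T : topologicalType) (d : T -> T -> R) (hd : is_dist d) :=
  Choice.copy (dist_space hd) T.

HB.instance Definition _ (T : topologicalType) (d : T -> T -> R) (hd : is_dist d) :=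
  isMetric.Build R (dist_space hd) (is_distxx hd) (is_dist_pos hd)
    (is_dist_sym hd) (is_dist_triangle hd).

(** A continuous bijection from a compact space to a Hausdorff one is closed; here it is the
    identity. *)
Lemma compact_metrizable T (d : T -> T -> R) : is_dist d -> compact [set: T] ->
  (forall x e, 0 < e -> \forall y \near x, d x y < e) -> metrizable R T.
Proof.
move=> hd cT dcont; pose M : metricType R := dist_space hd.
have cid : continuous (idfun : T -> M).
  move=> x; apply/cvg_ballP => e e0; rewrite ballEmdist.
  by apply: filterS (dcont x e e0) => y.
exists M, (idfun : T -> M), (idfun : M -> T); split=> //.
apply/continuous_closedP => C clC.
have : compact ((idfun : T -> M) @` C).
  apply: continuous_compact; first exact: continuous_subspaceT.
  exact: subclosed_compact clC cT _.
move=> /(compact_closed (@metric_hausdorff R M)).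
by rewrite image_id.
Qed.

End Subspaces.

(** * Metrizability of quotients and monotone maps *)

Section Metrization.
Context {R : realType}.

Lemma compact_pseudometric_base (X : pseudoMetricType R) :
  compact [set: X] -> exists b : nat -> set X,
    (forall n, open (b n)) /\
    forall x W, nbhs x W -> exists n, b n x /\ b n `<=` W.
Proof.
move=> cX; have [[x0 _]|X0] := pselect (exists x : X, True); last first.
  exists (fun=> set0); split=> [_|x]; first exact: open0.
  by exfalso; apply: X0; exists x.
pose P : pseudoPMetricType R := HB.pack (PseudoMetric.sort X)
  (PseudoMetric.class X) (isPointed.Build (PseudoMetric.sort X) x0).
have [B /countable_injP[g gi] [oB bB]] := @compact_second_countable R P cX.
(* [g] is injective on [B], so each union has at most one member; a number that codes nothing gives
   the empty set. *)
exists (fun n => \bigcup_(U in [set U | B U /\ g U = n]) U); split.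
  by move=> n; apply: bigcup_open => U [BU _]; exact: (oB U BU).
move=> x W nW; have [U [BU Ux] UW] := bB x W nW.
exists (g U); split; first by exists U.
move=> y [U' [BU' e]]; rewrite (gi U' U) ?inE//; exact: UW.
Qed.


(* Same as compact_cover, for a type without a chosen point. *)
Lemma compact_finite_cover (T : topologicalType) (A : set T) :
  compact A -> @cover_compact T A.
Proof.
have [[x0 _]|T0] := pselect (exists x : T, True); last first.
  move=> _ I D f _ _; exists fset0 => [i|x]; first by rewrite inE.
  by exfalso; apply: T0; exists x.
pose P : ptopologicalType := HB.pack (Topological.sort T)
  (Topological.class T) (isPointed.Build (Topological.sort T) x0).
by move=> cA; have : @compact P A := cA; rewrite compact_cover.
Qed.

(** The metric is the supremum over [n] of the distance of the values of [f n], divided by [n + 1].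
    The [f n] are bounded by 1 and the weights tend to 0, so only finitely many [n] matter for a
    given radius. *)
Lemma separating_metrizable (Y : topologicalType) (f : nat -> Y -> R) :
  compact [set: Y] -> (forall n, continuous (f n)) ->
  (forall n y, 0 <= f n y <= 1) ->
  (forall y y', (forall n, f n y = f n y') -> y = y') -> metrizable R Y.
Proof.
move=> cY cf f01 fsep.
pose t n (y y' : Y) : R := n.+1%:R^-1 * `|f n y - f n y'|.
have n0 n : 0 < n.+1%:R^-1 :> R by rewrite invr_gt0.
have fd n y y' : `|f n y - f n y'| <= 1.
  by have := f01 n y; have := f01 n y'; rewrite ler_norml => /andP[a b] /andP[c d]; lra.
have t0 n y y' : 0 <= t n y y' by apply: mulr_ge0 => //; exact: ltW.
pose d y y' := sup [set t n y y' | n in [set: nat]].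
have supt y y' : has_sup [set t n y y' | n in [set: nat]].
  split; first by exists (t 0%N y y'), 0%N.
  exists 1 => _ [n _ <-]; apply: mulr_ile1 => //; first exact: ltW.
  by rewrite invf_le1 ?ler1n// ltr0n.
have td n y y' : t n y y' <= d y y'.
  by apply: sup_upper_bound => //; exists n.
have dle y y' e : (forall n, t n y y' <= e) -> d y y' <= e.
  move=> te; apply: ge_sup; first by exists (t 0%N y y'), 0%N.
  by move=> _ [n _ <-].
have hd : is_dist d.
  split.
  - move=> x; apply/eqP; rewrite eq_le (le_trans (t0 0%N x x) (td _ _ _)) andbT.
    by apply: dle => n; rewrite /t subrr normr0 mulr0.
  - move=> x y dxy; apply: fsep => n; have := td n x y; rewrite dxy /t => h.
    have : `|f n x - f n y| <= 0 by rewrite -(pmulr_rle0 _ (n0 n)).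
    by rewrite normr_le0 subr_eq0 => /eqP.
  - move=> x y; congr sup; apply/seteqP; split=> _ [n _ <-]; exists n => //;
    by rewrite /t distrC.
  - move=> y x z; apply: dle => n; apply: le_trans (lerD (td n x y) (td n y z)).
    by rewrite /t -mulrDr ler_pM2l// ler_distD.
apply: (compact_metrizable hd cY) => x e e0.
have e2 : 0 < e / 2 by rewrite divr_gt0.
have [N hN] : exists N, N.+1%:R^-1 < e / 2.
  have [N hN] := @ltr_add_invr R 0 (e / 2) e2.
  by exists N; rewrite add0r in hN.
have : \forall y \near x, forall i : 'I_N, `|f i x - f i y| < e / 2.
  by apply: filter_forall => i; move/cvgrPdist_lt: (cf i x) => /(_ _ e2).
apply: filterS => y hy; apply: (@le_lt_trans _ _ (e / 2)); last by lra.
apply: dle => n; have [nN|Nn] := ltnP n N.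
  rewrite /t; have := hy (Ordinal nN) => /= /ltW h; apply: le_trans h.
  by rewrite ler_piMl// invf_le1// ler1n.
apply: le_trans (ltW hN); rewrite /t; apply: (@le_trans _ _ n.+1%:R^-1).
  by rewrite ler_piMr// ltW.
by rewrite lef_pV2 ?posrE// ler_nat.
Qed.

(** Countability is taken from [X]: one function on [Y] is selected for each pair of finite unions
    of basic open sets of [X]. Fibres are compact, so two distinct fibres are told apart by some
    such pair. *)
Lemma compact_image_metrizable (X : pseudoMetricType R) (Y : topologicalType)
    (f : X -> Y) : compact [set: X] -> continuous f -> (forall y, exists x, f x = y) ->
  hausdorff_space Y -> metrizable R Y.
Proof.
move=> cX cf fsurj hY.
have cY : compact [set: Y].
  have -> : [set: Y] = f @` [set: X].
    by apply/seteqP; split=> // y _; have [x <-] := fsurj y; exists x.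
  by apply: continuous_compact => //; exact: continuous_subspaceT.
have nY := compact_normal hY cY.
have [b [ob bb]] := compact_pseudometric_base cX.
pose G (s : seq nat) := \bigcup_(n in [set n | n \in s]) b n.
have GK (K W : set X) : compact K -> open W -> K `<=` W ->
    exists s, K `<=` G s /\ G s `<=` W.
  move=> cK oW KW; pose D := [set n | b n `<=` W].
  have [|x Kx|s sD Ks] := compact_finite_cover cK (D := D) (f := b).
  - by move=> n _; exact: ob.
  - have [n [bnx bnW]] := bb x W (open_nbhs_nbhs (conj oW (KW x Kx))).
    by exists n.
  - exists (enum_fset s); split=> [x /Ks[n ns bx]|x [n /= ns bx]]; first by exists n.
    by have /set_mem := sD n ns; exact.
(* Fibres inside the first union get value 0, those inside the second value 1. The choice [g] below
   takes the constant 0 for pairs that admit no such function. *)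
pose Phi (p : seq nat * seq nat) (g : Y -> R) :=
  [/\ continuous g, (forall y, 0 <= g y <= 1),
      (forall y, f @^-1` [set y] `<=` G p.1 -> g y = 0) &
      (forall y, f @^-1` [set y] `<=` G p.2 -> g y = 1)].
have /choice[g hg] : forall p, exists gp : Y -> R,
    [/\ continuous gp, (forall y, 0 <= gp y <= 1) &
    (exists g0, Phi p g0) -> Phi p gp].
  move=> p.
  have [[g0 h0]|h0] := pselect (exists g0, Phi p g0).
    by exists g0; case: (h0).
  exists (fun=> 0); split=> // [y|y]; first exact: cvg_cst.
  by rewrite lexx ler01.
pose h n := if @choice.unpickle (seq nat * seq nat)%type n is Some p then g p else fun=> 0.
apply: (@separating_metrizable Y h) => //.
- move=> n; rewrite /h; case: choice.unpickle => [p|y]; last exact: cvg_cst.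
  by case: (hg p).
- move=> n y; rewrite /h; case: choice.unpickle => [p|]; last by rewrite lexx ler01.
  by case: (hg p) => _ /(_ y).
move=> y y' hyy; apply: contrapT => yy'.
have clY (z : Y) : closed [set z].
  by apply: accessible_closed_set1; exact: hausdorff_accessible.
have yy0 : [set y] `&` [set y'] = set0 by apply/seteqP; split=> // z [-> /yy'].
have [u [cu u0 u1 _]] := urysohn_ext_itv nY (clY y) (clY y') yy0 (@ltr01 R).
have uy : u y = 0 by apply: u0; exists y.
have uy' : u y' = 1 by apply: u1; exists y'.
pose C0 := u @^-1` [set r | r <= 3^-1]; pose C1 := u @^-1` [set r | 2 / 3 <= r].
have clC0 : closed C0 by apply: preimage_closed => [z _|]; [exact: cu|exact: closed_le].
have clC1 : closed C1 by apply: preimage_closed => [z _|]; [exact: cu|exact: closed_ge].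
have C01 : C0 `&` C1 = set0.
  apply/seteqP; split=> // z [a b']; have : 2 / 3 <= 3^-1 :> R := le_trans b' a.
  by move=> ab'; exfalso; clear -ab'; lra.
(* [v] serves only to show that the pair [(s, s')] found below admits a function; the selected
   [g (s, s')] then separates the points as well. *)
have [v [cv v0 v1 v01]] := urysohn_ext_itv nY clC0 clC1 C01 (@ltr01 R).
have cfib z : compact (f @^-1` [set z]).
  apply: subclosed_compact cX _ => //.
  by apply: preimage_closed => [w _|]; [exact: cf|exact: clY].
have oW0 : open (f @^-1` (u @^-1` [set r | r < 3^-1])).
  apply: open_comp => [w _|]; first exact: cf.
  by apply: open_comp => [w _|]; [exact: cu|exact: open_lt].
have oW1 : open (f @^-1` (u @^-1` [set r | 2 / 3 < r])).
  apply: open_comp => [w _|]; first exact: cf.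
  by apply: open_comp => [w _|]; [exact: cu|exact: open_gt].
have [s [s1 s2]] : exists s, f @^-1` [set y] `<=` G s /\
    G s `<=` f @^-1` (u @^-1` [set r | r < 3^-1]).
  by apply: GK => // x /= ->; rewrite uy invr_gt0.
have [s' [s1' s2']] : exists s, f @^-1` [set y'] `<=` G s /\
    G s `<=` f @^-1` (u @^-1` [set r | 2 / 3 < r]).
  by apply: GK => // x /= ->; rewrite uy'; lra.
have [_ _ /(_ _)[|_ _ g0 g1]] := hg (s, s').
  exists v; split=> //=.
  - by move=> z; have := v01 (v z); rewrite /= in_itv; apply; exists z.
  - move=> z zs; apply: v0; exists z => //; have [x e] := fsurj z.
    by have /= := s2 x (zs x e); rewrite e => /ltW.
  - move=> z zs; apply: v1; exists z => //; have [x e] := fsurj z.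
    by have /= := s2' x (zs x e); rewrite e => /ltW.
have := hyy (choice.pickle (s, s')); rewrite /h choice.pickleK (g0 y s1) (g1 y' s1').
by move=> /eqP; rewrite eq_sym oner_eq0.
Qed.

(** A connected fibre is not divided by a separation of the preimage, so both pieces are saturated,
    and their images are closed, disjoint and separate [L]. *)
Lemma monotone_preimage_connected (X Y : topologicalType) (f : X -> Y) (L : set Y) :
  compact [set: X] -> hausdorff_space Y -> continuous f ->
  (forall y, exists x, f x = y) -> (forall y, connected (f @^-1` [set y])) ->
  closed L -> connected L -> connected (f @^-1` L).
Proof.
move=> cX hY cf fsurj kf clL kL; apply: contrapT => /connectedPn[E [E0 LE sE]].
have [sE1 sE2] := sE.
have clfL : closed (f @^-1` L) by apply: preimage_closed => // x _; exact: cf.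
have clE b : closed (E b) by exact: separated_closed clfL LE sE.
have clfE b : closed (f @` E b).
  apply: compact_closed => //; apply: continuous_compact.
    exact: continuous_subspaceT.
  exact: subclosed_compact cX _.
have fE y b : L y -> (f @` E b) y -> f @^-1` [set y] `<=` E b.
  move=> Ly [x Ex fx].
  have [] := connected_subset sE _ (kf y).
  - by rewrite -LE => z /= ->.
  - move=> h; case: b Ex => // Ex.
    have : (closure (E false) `&` E true) x by split=> //; apply/subset_closure/h.
    by rewrite sE1.
  - move=> h; case: b Ex => // Ex.
    have : (E false `&` closure (E true)) x by split=> //; apply/subset_closure/h.
    by rewrite sE2.
have fEL b : f @` E b `<=` L.
  move=> _ [x Ex <-]; have : (f @^-1` L) x by rewrite LE; case: b Ex; [right|left].
  by [].
have EE0 x : E false x -> E true x -> False.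
  by move=> h1 h2; have : (closure (E false) `&` E true) x by
    [split=> //; exact: subset_closure]; rewrite sE1.
have fEU : L = f @` E false `|` f @` E true.
  apply/seteqP; split=> y; last by case=> [/fEL|/fEL].
  move=> Ly; have [x fx] := fsurj y; have : (f @^-1` L) x by rewrite /= fx.
  by rewrite LE => -[]; [left|right]; exists x.
have fE0 : f @` E false `&` f @` E true = set0.
  apply/seteqP; split=> // y [h1 h2]; have Ly := fEL _ _ h1.
  have [x fx] := fsurj y.
  by apply: (EE0 x); [exact: fE h1 _ fx|exact: fE h2 _ fx].
move: kL => /connectedP/(_ (fun b => f @` E b)); apply; split=> //.
  by move=> b; have [x Ex] := E0 b; exists (f x), x.
by split; rewrite -(closure_id _).1.
Qed.

End Metrization.

(** * Diameters and Lebesgue numbers *)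

Section Diameter.
Context {R : realType} {S : metricType R}.
Implicit Types (X Y : set S).

Lemma compact_mdist_bounded : compact [set: S] ->
  exists M : R, forall x y : S, mdist x y <= M.
Proof.
move=> cS; have [[x0 _]|S0] := pselect (exists x : S, True); last first.
  by exists 0 => x; exfalso; apply: S0; exists x.
have /compact_near_coveringP nS := cS.
have [x _|N _ h] := nS nat \oo (fun n x => mdist x0 x < n%:R) _.
  have [n hn] : exists n : nat, mdist x0 x + 1 < n%:R.
    by exists (Num.truncn (mdist x0 x + 1)).+1; exact: truncnS_gt.
  exists (ball x 1, [set m | (n <= m)%N]) => /=.
    by split; [exact: nbhsx_ballx|exists n].
  move=> [y m] [/=]; rewrite ballEmdist /= => xy nm.
  apply: le_lt_trans (metric_triangle x0 x y) _.
  apply: lt_le_trans (lt_trans _ hn) _; first by rewrite ltrD2l.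
  by rewrite ler_nat.
exists (N%:R + N%:R) => x y; apply: le_trans (metric_triangle x x0 y) _.
by rewrite lerD// ?(metric_sym x x0) ltW//; apply: (h N) => //=.
Qed.

(** A [sup] is an upper bound only for bounded sets; compactness of [S] provides the bound. *)
Lemma diam_ub X x y : compact [set: S] -> X x -> X y -> mdist x y <= diam X.
Proof.
move=> /compact_mdist_bounded[M hM] Xx Xy; apply: sup_upper_bound.
  by split; [exists (mdist x y), x => //; exists y|exists M => _ [u _ [v _ <-]]].
by exists x => //; exists y.
Qed.

Lemma diam_le X (e : R) : 0 <= e -> (forall x y, X x -> X y -> mdist x y <= e) ->
  diam X <= e.
Proof.
move=> e0 Xe; rewrite /diam.
have [->|/set0P X0] := eqVneq [set mdist x y | x in X & y in X] set0.
  by rewrite sup0.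
by apply: ge_sup => // _ [x Xx [y Xy <-]]; exact: Xe.
Qed.

Lemma diam_ge0 X : compact [set: S] -> 0 <= diam X.
Proof.
move=> cS; have [->|/set0P[x Xx]] := eqVneq X set0.
  rewrite /diam (_ : [set _ | _ in _ & _ in _] = set0) ?sup0//.
  by apply/seteqP; split=> // r [].
by rewrite -(mdistxx x); exact: diam_ub.
Qed.

Lemma diam_subset X Y : compact [set: S] -> X `<=` Y -> diam X <= diam Y.
Proof.
move=> cS XY; apply: diam_le; first exact: diam_ge0.
by move=> x y /XY Yx /XY Yy; exact: diam_ub.
Qed.

Lemma diam_closure X : compact [set: S] -> diam (closure X) <= diam X.
Proof.
move=> cS; apply: diam_le; first exact: diam_ge0.
move=> x y clx cly; apply/ler_addgt0Pr => e e0.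
have e2 : 0 < e / 2 by rewrite divr_gt0.
have [x' [Xx']] := clx _ (nbhsx_ballx x _ e2).
have [y' [Xy']] := cly _ (nbhsx_ballx y _ e2).
rewrite !ballEmdist /= => yy' xx'; rewrite metric_sym in yy'.
have h := diam_ub cS Xx' Xy'.
apply: le_trans (metric_triangle x x' y) _.
have := metric_triangle x' y' y; lra.
Qed.

Lemma lebesgue_number (I : Type) (G : I -> set S) : compact [set: S] ->
  (forall x, exists2 i, open (G i) & G i x) ->
  exists2 e : R, 0 < e & forall x, exists i, ball x e `<=` G i.
Proof.
move=> cS cov; have /compact_near_coveringP nS := cS.
have : \forall e \near 0^'+, [set: S] `<=` (fun x => exists i, ball x e `<=` G i).
  apply: nS => x _; have [i oG Gx] := cov x.
  have /nbhs_ballP[r /= r0 rG] := open_nbhs_nbhs (conj oG Gx).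
  have r2 : 0 < r / 2 by rewrite divr_gt0.
  exists (ball x (r / 2), [set e : R | e < r / 2]) => /=.
    by split; [exact: nbhsx_ballx|exact: nbhs_right_lt].
  move=> [y e] [/= xy er]; exists i => z yz; apply: rG.
  rewrite [r]splitr; apply: ball_triangle xy _.
  by apply: le_ball yz; exact: ltW.
move=> h; have [e [e0 he]] : exists e : R, 0 < e /\
    [set: S] `<=` (fun x => exists i, ball x e `<=` G i).
  near (0 : R)^'+ => e; exists e; split; first by near: e; exact: nbhs_right_gt.
  by near: e.
by exists e => // x; exact: he.
Unshelve. all: by end_near. Qed.

End Diameter.

(** * Plaques and leaves *)

Section Foliation.
Context {R : realType} {S : metricType R}.
Implicit Types (A B F : atlas_data S) (U V W D E K L : set S) (x y : S).

Lemma decomposition_plaque D (Q : S -> set S) x :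
  decomposition D Q -> D x -> subcontinua D (Q x) /\ Q x x.
Proof. by move=> [+ _ _]; apply. Qed.

Lemma decomposition_eq D (Q : S -> set S) x y :
  decomposition D Q -> D x -> Q x y -> Q y = Q x.
Proof.
move=> [Q1 Q2 _] Dx Qxy; have [[_ QD _ _] _] := Q1 x Dx.
have [//|QQ0] := Q2 y x (QD _ Qxy) Dx.
have [_ Qyy] := Q1 y (QD _ Qxy).
by have : (Q y `&` Q x) y by []; rewrite QQ0.
Qed.

(** Compatibility is read on the smaller closure: the plaque over [U] is already connected, so it is
    a component of the trace of the larger plaque. *)
Lemma plaque_subset F U V x : is_atlas F -> atlas_cover F U -> atlas_cover F V ->
  closure U `<=` closure V -> closure U x ->
  plaques F (closure U) x `<=` plaques F (closure V) x.
Proof.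
move=> [_ _ dF cF] FU FV UV Ux; have [[_ QU _ kQ] Qx] := decomposition_plaque (dF U FU) Ux.
have := cF U V FU FV x (conj Ux (UV _ Ux)).
rewrite /mrestr (setIidl UV) (setIidl QU) connected_component_id// => -> y.
by move=> /connected_component_sub[].
Qed.

(** A plaque [K] in the interior of [D] absorbs every open plaque of [B] that meets it, so a chain
    started in [K] never leaves it. *)
Lemma leaf_subset_plaque F B U y : is_atlas F -> is_atlas B -> subatlas B F ->
  atlas_cover F U -> closure U y ->
  plaques F (closure U) y `<=` (closure U)° -> leaf B y `<=` plaques F (closure U) y.
Proof.
move=> aF aB BF FU Uy; set D := closure U; set K := plaques F D y => KD.
have [_ _ dF cF] := aF.
have [[_ KsubD cK kK] Ky] := decomposition_plaque (dF U FU) Uy.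
have hS := @metric_hausdorff R S.
have key P : open_plaque B P -> P `&` K !=set0 -> P `<=` K.
  move=> [W [w [BW Ww ->]]] [t [Pt Kt]].
  have [FW e] := BF W BW.
  have Ww' : closure W w by exact: subset_closure.
  rewrite /mrestr e// in Pt *; set L := plaques F (closure W) w in Pt *.
  have [Lt Wt] := connected_component_sub Pt.
  have [[_ LW cL kL] _] := decomposition_plaque (dF W FW) Ww'.
  have eL : plaques F (closure W) t = L by exact: decomposition_eq (dF W FW) Ww' Lt.
  have eK : plaques F D t = K by exact: decomposition_eq (dF U FU) Uy Kt.
  have Dt := KsubD t Kt; have Wt' := LW t Lt.
  (* Compatibility puts the component at [t] of the part of [L] in [D] inside [K], hence in the
     interior of [D]; boundary bumping then keeps all of [L] in [D]. *)
  have := cF U W FU FW t (conj Dt Wt').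
  rewrite /mrestr -/D eL eK => eC.
  have eLD : L `&` (D `&` closure W) = L `&` D.
    by rewrite setICA (setIidl LW) setIC.
  have CK : connected_component (L `&` D) t `<=` K.
    by rewrite -eLD -eC => z /connected_component_sub[].
  have LD : L `<=` D.
    apply: (boundary_bumping hS cL kL _ Lt Dt); first exact: closed_closure.
    exact: subset_trans CK KD.
  rewrite (setIidl LD) connected_component_id// in CK.
  by move=> z /connected_component_sub[/CK].
move=> z [n [P [oP P0 Pn PP]]].
suff h i : (i <= n)%N -> P i `<=` K by exact: (h n (leqnn n)).
elim: i => [|i IH] in_; first by apply: key; [exact: oP|exists y].
have [t [Pt Pt']] := PP i in_; apply: key; first exact: oP.
by exists t; split=> //; apply: IH Pt; exact: ltnW.
Qed.

Lemma plaque_reaches_frontier F B U (e : R) y : compact [set: S] ->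
  is_atlas F -> is_atlas B -> subatlas B F -> 0 < e ->
  (forall x, e <= diam (leaf B x)) ->
  atlas_cover F U -> diam (closure U) < e -> closure U y ->
  ~ plaques F (closure U) y `<=` (closure U)°.
Proof.
move=> cS aF aB BF e0 he FU dU Uy QU.
have := leaf_subset_plaque aF aB BF FU Uy QU; have [_ _ dF _] := aF.
have [[_ KsubD _ _] _] := decomposition_plaque (dF U FU) Uy.
move=> /(subset_trans)/(_ KsubD)/(diam_subset cS) h.
by have := lt_le_trans (le_lt_trans h dU) (he y); rewrite ltxx.
Qed.

(** A point of [O] off the saturated set [X] has its plaque off [C]; being connected, that plaque
    cannot cross the frontier of [O], so it would stay in the interior of [D]. [X] will be a single
    plaque in one use and [C] itself in the other. *)
Lemma saturated_complement_empty D (Q : S -> set S) (O C X : set S) :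
  decomposition D Q -> (forall y, D y -> ~ Q y `<=` D°) ->
  open O -> O `<=` D -> O `<=` ~` C -> closure O `<=` O `|` C -> C `<=` X ->
  (forall x y, D y -> X x -> Q y x -> X y) -> O `<=` X.
Proof.
move=> dQ nQ oO OD OC clO CX satX y Oy; apply: contrapT => Xy.
have [[_ QD _ kQ] Qy] := decomposition_plaque dQ (OD _ Oy).
apply: (nQ y (OD _ Oy)); apply: subset_trans (_ : O `<=` _); last first.
  by move=> z Oz; apply: (filterS OD); exact: open_nbhs_nbhs.
have QC z : Q y z -> ~ C z.
  by move=> Qz /CX Xz; apply: Xy; exact: (satX z y (OD _ Oy)).
suff <- : Q y `&` O = Q y by move=> z [].
apply: kQ; first by exists y.
- by exists O.
- exists (closure O); first exact: closed_closure.
  apply/seteqP; split=> z [Qz Oz]; split=> //; first exact: subset_closure.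
  by case: (clO z Oz) => // /(QC z Qz).
Qed.

End Foliation.

(** * Plaques as dendrites *)

Section Dendrites.
Context {R : realType} {S : metricType R}.
Implicit Types (A B F : atlas_data S) (U V W D E K L X Y M N : set S) (x y : S).

(** The conclusion of Janiszewski's theorem as a property of [D] alone, which hides the chart from
    the arguments about plaques. *)
Definition cut_by_continua D := forall X Y M N,
  compact X -> compact Y -> connected X -> connected Y -> X `<=` D -> Y `<=` D ->
  closed M -> closed N -> M !=set0 -> N !=set0 -> M `&` N = set0 ->
  X `&` Y = M `|` N ->
  exists O, [/\ open O, O !=set0, O `<=` D, O `<=` ~` (X `|` Y) &
    closure O `<=` O `|` (X `|` Y)].

(** [E] is the image of a closed square of a chart. The cutting property is stated for every
    liftable compact set in [E], since both [E] and the given disc will be needed. *)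
Lemma surface_local_disc x W : compact_surface S -> open W -> W x ->
  exists G E, [/\ open G, G x, G `<=` E, E `<=` W & compact E] /\
    @liftable R S E /\
    forall D, D `<=` E -> compact D -> @liftable R S D -> cut_by_continua D.
Proof.
move=> [_ /(_ x)[U [V [oU Ux oV hUV]]]] oW Wx.
have hS := @metric_hausdorff R S.
have [phi [psi [cphi cpsi UV VU]]] := homeomorphic_sets x (0 : R * R) hUV.
have [Vx ex] := UV x Ux.
have cpsix : {for phi x, continuous psi}.
  by move: cpsi; rewrite continuous_open_subspace// => /(_ (phi x)); apply; rewrite inE.
have cphiU y : U y -> {for y, continuous phi}.
  by move=> Uy; move: cphi; rewrite continuous_open_subspace// => /(_ y); apply; rewrite inE.
have nW : nbhs (phi x) (V `&` psi @^-1` W).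
  apply: filterI; first exact: open_nbhs_nbhs.
  by apply: cpsix; rewrite ex; exact: open_nbhs_nbhs.
have [r r0 rW] := nbhs_box nW.
have rV : box (phi x) r `<=` V by move=> z /rW[].
pose E := psi @` box (phi x) r.
have EU : E `<=` U by move=> _ [z /rV/VU[Uz _] <-].
exists (U `&` phi @^-1` (box (phi x) r)°), E; split; split.
- rewrite openE => y [Uy by_]; apply: filterI; first exact: open_nbhs_nbhs.
  by apply: cphiU => //; exact: open_nbhs_nbhs (conj (@open_interior _ _) by_).
- by split=> //; exact: box_nbhs.
- move=> y [Uy /interior_subset by_]; exists (phi y) => //.
  by have [] := UV y Uy.
- by move=> _ [z /rW[_ Wz] <-].
- apply: continuous_compact; last exact: box_compact.
  exact: continuous_subspaceW cpsi.
- apply: (@liftable_homeo _ _ _ _ (box (phi x) r) phi psi).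
  + exact: continuous_subspaceW cphi.
  + exact: continuous_subspaceW cpsi.
  + by move=> _ [z bz <-]; have [_ ->] := VU z (rV z bz).
  + by move=> z bz; exists z.
  + by apply: (@liftable_star _ (phi x)); [exact: box_compact|exact: box_star].
- move=> D DE cD lD X Y M N *.
  apply: (@chart_component R S U V phi psi D X Y M N) => //.
  exact: subset_trans EU.
Qed.

(** A single open plaque over [V] already contains the plaque over [closure U]; through it
    meagreness passes from leaves of [B] to plaques of [F]. *)
Lemma plaque_subset_leaf F B U V x : is_atlas F -> subatlas B F ->
  atlas_cover F U -> atlas_cover B V -> closure U `<=` V -> closure U x ->
  plaques F (closure U) x `<=` leaf B x.
Proof.
move=> aF BF FU BV UV Ux y Qy; have [FV e] := BF V BV; have [_ _ dF _] := aF.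
have UV' : closure U `<=` closure V by move=> z /UV; exact: subset_closure.
have [[_ QU _ kQ] Qx] := decomposition_plaque (dF U FU) Ux.
pose P := mrestr (plaques B (closure V)) V x.
have QP : plaques F (closure U) x `<=` P.
  apply: connected_component_max => //; rewrite e; last exact: UV'.
  move=> z Qz; split; first exact: (plaque_subset aF FU FV UV' Ux).
  exact/UV/QU.
exists 0%N, (fun=> P); split=> // [_ _||].
- by exists V, x; split=> //; exact: UV.
- exact: QP.
- exact: QP.
Qed.

(** The continua live in [E], where cutting is available, while the plaque belongs to [closure U],
    which may be larger and need not be a disc. The open set of a cut would be filled by this
    plaque, against Baire's theorem. *)
Lemma plaque_not_cut F B U V E (e : R) x X Y M N : compact [set: S] ->
  is_atlas F -> is_atlas B -> subatlas B F -> 0 < e ->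
  (forall x, e <= diam (leaf B x)) -> (forall x, meagre (leaf B x)) ->
  atlas_cover F U -> atlas_cover B V -> closure U `<=` V ->
  diam (closure U) < e -> closure U x -> E `<=` closure U -> cut_by_continua E ->
  compact X -> compact Y -> connected X -> connected Y -> X `<=` E -> Y `<=` E ->
  X `|` Y `<=` plaques F (closure U) x ->
  closed M -> closed N -> M !=set0 -> N !=set0 -> M `&` N = set0 ->
  X `&` Y = M `|` N -> False.
Proof.
move=> cS aF aB BF e0 he mB FU BV UV dU Ux EU cutE cX cY kX kY XE YE XYQ clM clN
  M0 N0 MN0 XYMN.
have [_ _ dF _] := aF.
have [O [oO O0 OE OXY clO]] := cutE X Y M N cX cY kX kY XE YE clM clN M0 N0 MN0 XYMN.
have OQ : O `<=` plaques F (closure U) x.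
  apply: (saturated_complement_empty (dF U FU) _ oO _ OXY clO XYQ).
  - by move=> y; exact: (plaque_reaches_frontier cS aF aB BF e0 he FU dU).
  - exact: subset_trans EU.
  - move=> y z Uz Qy Qzy; have [_ Qz] := decomposition_plaque (dF U FU) Uz.
    by rewrite -(decomposition_eq (dF U FU) Ux Qy) (decomposition_eq (dF U FU) Uz Qzy).
have [Fn ndF lF] := mB x.
apply: (baire_compact cS oO O0 ndF); apply: subset_trans lF.
by apply: subset_trans OQ _; exact: (plaque_subset_leaf aF BF FU BV UV Ux).
Qed.

(* A plaque that no continua cut is hereditarily unicoherent, so a connected
   neighbourhood in an open plaque meets a smaller plaque in a connected set. *)
Lemma plaque_locally_connected F U D G L x : is_atlas F ->
  compact [set: S] -> atlas_cover F U -> U x ->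
  locally_connected (set_type (mrestr (plaques F (closure U)) U x)) ->
  open G -> G `<=` D -> L `<=` G -> G `<=` U ->
  compact L -> connected L -> L x -> L `<=` plaques F (closure U) x ->
  (forall X Y M N, compact X -> compact Y -> connected X -> connected Y ->
    X `<=` D -> Y `<=` D -> X `|` Y `<=` plaques F (closure U) x ->
    closed M -> closed N -> M !=set0 -> N !=set0 -> M `&` N = set0 ->
    X `&` Y = M `|` N -> False) ->
  locally_connected (set_type L).
Proof.
move=> aF cS FU Ux lcP oG GD LG GU cL kL Lx LQ uni.
have [_ _ dF _] := aF; have hS := @metric_hausdorff R S.
have [[_ QU cQ kQ] Qx] := decomposition_plaque (dF U FU) (subset_closure Ux).
have clQ := compact_closed hS cQ; have clL := compact_closed hS cL.
have LP : L `<=` mrestr (plaques F (closure U)) U x.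
  by apply: connected_component_max => // z Lz; split; [exact: LQ|exact/GU/LG].
apply: im_kleinen_locally_connected => z W Lz nW.
have [W0 nW0 W0W] := @uniform_regular S z _ (filterI nW (open_nbhs_nbhs (conj oG (LG z Lz)))).
have [V [kV VPW Vz nV]] := locally_connected_im_kleinen lcP (LP z Lz) nW0.
have VW : closure V `<=` W `&` G.
  by apply: subset_trans W0W; apply: closureS => y /VPW[].
have VQ : closure V `<=` plaques F (closure U) x.
  move=> y clVy; apply: clQ; apply: closureS clVy => u /VPW[Pu _].
  by have [] := connected_component_sub Pu.
have cV : compact (closure V).
  by apply: subclosed_compact cS _ => //; exact: closed_closure.
(* Closing [V] makes it a continuum that stays in [W], in [G] and in the plaque, so that [uni]
   applies to [closure V] and [L]. *)
exists (closure V `&` L); split.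
- apply: contrapT => /connectedPn[E [E0 LE sE]]; have [sE1 _] := sE.
  have clVL : closed (closure V `&` L) by apply: closedI => //; exact: closed_closure.
  have clE b : closed (E b) by exact: separated_closed clVL LE sE.
  apply: (uni (closure V) L (E false) (E true)) => //.
  + exact: connected_closure.
  + by move=> y /VW[_ /GD].
  + exact: subset_trans GD.
  + by move=> y [/VQ|/LQ].
  + by apply/seteqP; split=> // y [h1 h2]; rewrite -sE1; split=> //; exact: subset_closure.
- by move=> y [/VW[Wy _] Ly].
- by split=> //; exact: subset_closure.
- by apply: filterS nV => y Vy Ly; split=> //; apply/subset_closure/Vy/LP.
Qed.

Lemma compact_set_metrizable L : compact L -> metrizable R (set_type L).
Proof.
move=> cL; pose d (u v : set_type L) : R := mdist (set_val u) (set_val v).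
have hd : is_dist d.
  split.
  - by move=> u; rewrite /d mdistxx.
  - by move=> u v /mdist_positivity/val_inj.
  - by move=> u v; rewrite /d metric_sym.
  - by move=> u v w; exact: metric_triangle.
apply: (compact_metrizable hd).
  by apply: set_type_compact; rewrite set_val_imageT.
move=> u r r0; apply/nbhs_set_typeP.
exists (ball (set_val u) r); first exact: nbhsx_ballx.
by rewrite ballEmdist.
Qed.

Lemma set_type_continuum L : compact L -> connected L -> continuum R (set_type L).
Proof.
move=> cL kL; split; first exact: compact_set_metrizable.
- by apply: set_type_compact; rewrite set_val_imageT.
- by apply: set_type_connected; rewrite set_val_imageT.
Qed.

Lemma no_curve_set_type L :
  (forall X Y M N, compact X -> compact Y -> connected X -> connected Y ->
    X `<=` L -> Y `<=` L ->
    closed M -> closed N -> M !=set0 -> N !=set0 -> M `&` N = set0 ->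
    X `&` Y = M `|` N -> False) ->
  ~ exists C : set (set_type L), simple_closed_curve R C.
Proof.
move=> uni [C /simple_closed_curve_arcs[X [Y [p [q [[cX cY kX kY] [_ _ XYpq pq]]]]]]].
have cv (Z : set (set_type L)) : {within Z, continuous (set_val : set_type L -> S)}.
  by apply: continuous_subspaceT; exact: initial_continuous.
have cl1 y : closed [set y].
  by apply: accessible_closed_set1; exact/hausdorff_accessible/metric_hausdorff.
apply: (uni (set_val @` X) (set_val @` Y) [set set_val p] [set set_val q]) => //.
- by apply: continuous_compact.
- by apply: continuous_compact.
- exact: connected_continuous_connected.
- exact: connected_continuous_connected.
- by move=> _ [u _ <-]; exact: set_valP.
- by move=> _ [u _ <-]; exact: set_valP.
- by exists (set_val p).
- by exists (set_val q).
- apply/seteqP; split=> // y [/= -> /val_inj e].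
  by move: pq; rewrite e eqxx.
- apply/seteqP; split=> [_ [[u Xu <-] [v Yv /val_inj e]]|y].
    by have : (X `&` Y) u by [split=> //; rewrite -e]; rewrite XYpq => -[->|->]; [left|right].
  have [Xp Yp] : (X `&` Y) p by rewrite XYpq; left.
  have [Xq Yq] : (X `&` Y) q by rewrite XYpq; right.
  by move=> [->|->]; split; [exists p|exists p|exists q|exists q].
Qed.

End Dendrites.
Local Open Scope quotient_scope.

(** * The quotient by plaques *)

Section PlaqueSpace.
Context {R : realType} {S : metricType R} (D : set S) (Q : S -> set S).
Hypotheses (dQ : decomposition D Q) (cD : compact D).

Definition plaque_pi : set_type D -> plaque_space D Q :=
  \pi_{eq_quot (plaque_equiv D Q)}.

Lemma plaque_piP (u v : set_type D) :
  plaque_pi u = plaque_pi v <-> Q (set_val u) = Q (set_val v).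
Proof.
split; first by move=> /eqquotP/asboolP.
by move=> e; apply/eqquotP/asboolP.
Qed.

Lemma plaque_pi_surj (y : plaque_space D Q) : exists u, plaque_pi u = y.
Proof. by exists (repr y); exact: reprK. Qed.

Lemma plaque_pi_continuous : continuous plaque_pi.
Proof. exact: pi_continuous. Qed.

Lemma plaque_pi_open (U : set (plaque_space D Q)) :
  open (plaque_pi @^-1` U) -> open U.
Proof. by []. Qed.

Lemma plaque_piE (u v : set_type D) : plaque_pi u = plaque_pi v <-> Q (set_val v) (set_val u).
Proof.
split=> [/plaque_piP <-|h].
  by have [] := decomposition_plaque dQ (set_valP u).
by apply/plaque_piP; exact: decomposition_eq dQ (set_valP v) h.
Qed.

Lemma plaque_space_hausdorff : hausdorff_space (plaque_space D Q).
Proof.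
have hS := @metric_hausdorff R S.
rewrite open_hausdorff => y y' yy'.
have [u uy] := plaque_pi_surj y; have [v vy'] := plaque_pi_surj y'.
have [[_ _ cu _] Qu] := decomposition_plaque dQ (set_valP u).
have [[_ _ cv _] Qv] := decomposition_plaque dQ (set_valP v).
have uv0 : Q (set_val u) `&` Q (set_val v) = set0.
  have [_ /(_ _ _ (set_valP u) (set_valP v))[e|//] _] := dQ.
  by move: yy'; rewrite -uy -vy' => /eqP; case; apply/plaque_piP.
have [U [V [oU oV QU QV UV0]]] := (@normal_openP R _).1 (@pseudometric_normal R S)
  _ _ (compact_closed hS cu) (compact_closed hS cv) uv0.
(* The classes whose plaques lie inside [W]: for open [W], upper semicontinuity is what makes this
   set open. *)
pose sat (W : set S) := plaque_pi @` [set w | Q (set_val w) `<=` W].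
have satE W : plaque_pi @^-1` sat W = [set w | Q (set_val w) `<=` W].
  apply/seteqP; split=> [w [z zW /plaque_piP e]|w wW]; last by exists w.
  by rewrite /= -e.
have osat W : open W -> open (sat W).
  move=> oW; apply: plaque_pi_open; rewrite satE openE => w wW.
  have [_ _ /(_ _ _ (set_valP w) oW wW) nW] := dQ.
  apply/nbhs_set_typeP; exists (fun y => D y -> Q y `<=` W) => // z; apply.
  exact: set_valP.
exists (sat U, sat V); first by split; rewrite inE; [exists u|exists v].
split; [exact: osat|exact: osat|].
apply/eqP/seteqP; split=> // w [[a aU <-] [b bV /plaque_piP e]].
have [_ Qa] := decomposition_plaque dQ (set_valP a).
have : (U `&` V) (set_val a) by split; [exact: aU Qa|apply: bV; rewrite e].
by rewrite UV0.
Qed.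

Lemma plaque_pi_fiber_connected y : connected (plaque_pi @^-1` [set y]).
Proof.
have [u <-] := plaque_pi_surj y.
have [[_ QD _ kQ] _] := decomposition_plaque dQ (set_valP u).
apply: set_type_connected.
rewrite (_ : _ @^-1` _ = set_val @^-1` Q (set_val u)).
  by rewrite set_val_image_preimage.
by apply/seteqP; split=> w /plaque_piE.
Qed.

Lemma plaque_space_dendrite : closed_disc R D -> cut_by_continua D ->
  (forall y, D y -> ~ Q y `<=` D°) -> dendrite R (plaque_space D Q).
Proof.
move=> dD cutD nQ; have hS := @metric_hausdorff R S.
have cX : compact [set: set_type D].
  by apply: set_type_compact; rewrite set_val_imageT.
have piT : [set: plaque_space D Q] = plaque_pi @` setT.
  by apply/seteqP; split=> // y _; have [u <-] := plaque_pi_surj y; exists u.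
have cpi A : {within A, continuous plaque_pi}.
  exact/continuous_subspaceT/plaque_pi_continuous.
have kX : connected [set: set_type D].
  have [f [g [fK gK cf cg]]] := dD.
  have -> : [set: set_type D] = g @` setT.
    by apply/seteqP; split=> // u _; exists (f u).
  apply: connected_continuous_connected; last exact: continuous_subspaceT.
  apply: set_type_connected; rewrite set_val_imageT.
  exact: star_connected star_closed_unit_disc.
have hY := plaque_space_hausdorff.
have metY : metrizable R (plaque_space D Q).
  apply: (@compact_image_metrizable R (set_type D) _ plaque_pi) => //.
  - exact: plaque_pi_continuous.
  - exact: plaque_pi_surj.
have cY : compact [set: plaque_space D Q] by rewrite piT; exact: continuous_compact.
split; [split; [split=> //|]|].
- by rewrite piT; exact: connected_continuous_connected.
(* Components of open sets are open in a quotient of a locally connected space: a small connected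
   set around a point over [C] has its image inside [C]. *)
- move=> y W nW; pose C := connected_component W° y.
  have Wy : W° y by exact: nW.
  exists C; split.
  + apply: plaque_pi_open; rewrite openE => u Cu.
    have Wu := connected_component_sub Cu.
    have nWu : nbhs u (plaque_pi @^-1` W°).
      by apply: plaque_pi_continuous; apply: open_nbhs_nbhs; split=> //; exact: open_interior.
    have [V [oV Vu kV VW]] := closed_disc_locally_connected dD nWu.
    apply: filterS (open_nbhs_nbhs (conj oV Vu)) => v Vv.
    rewrite /C /= (same_connected_component Cu).
    apply: (@connected_component_max _ _ (plaque_pi @` V)).
    * by exists u.
    * by move=> _ [w /VW ? <-].
    * exact: connected_continuous_connected.
    * by exists v.
  + exact: connected_component_refl.
  + exact: component_connected.
  + by move=> z /connected_component_sub/interior_subset.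
move=> [C /simple_closed_curve_arcs[X [Y [p [q [[cX' cY' kX' kY'] [_ _ XYpq pq]]]]]]].
have cl1 y : closed [set y : plaque_space D Q].
  by apply: accessible_closed_set1; exact: hausdorff_accessible.
(* The union in [S] of the plaques that belong to [Z]. *)
pose lft (Z : set (plaque_space D Q)) : set S := set_val @` (plaque_pi @^-1` Z).
have lftD Z : lft Z `<=` D by move=> _ [u _ <-]; exact: set_valP.
have lftP Z (u : set_type D) : lft Z (set_val u) <-> Z (plaque_pi u).
  by split=> [[v Zv /val_inj <-]|Zu] //; exists u.
have clft Z : closed Z -> compact (lft Z).
  move=> clZ; apply: continuous_compact.
    by apply: continuous_subspaceT; exact: initial_continuous.
  apply: subclosed_compact cX _ => //.
  by apply: preimage_closed => // u _; exact: plaque_pi_continuous.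
have klft Z : closed Z -> connected Z -> connected (lft Z).
  move=> clZ kZ; apply: connected_continuous_connected.
    apply: monotone_preimage_connected => //.
    - exact: plaque_pi_continuous.
    - exact: plaque_pi_surj.
    - exact: plaque_pi_fiber_connected.
  by apply: continuous_subspaceT; exact: initial_continuous.
have lft0 y : lft [set y] !=set0.
  by have [u uy] := plaque_pi_surj y; exists (set_val u); apply/lftP.
have clX := compact_closed hY cX'; have clY := compact_closed hY cY'.
have lftI Z Z' : lft Z `&` lft Z' = lft (Z `&` Z').
  apply/seteqP; split=> [_ [[u Zu <-] /lftP Z'u]|_ [u [Zu Z'u] <-]].
    by exists u.
  by split; exists u.
have [||O [oO [o Oo] OD OXY clO]] := cutD (lft X) (lft Y) (lft [set p]) (lft [set q])
  (clft _ clX) (clft _ clY) (klft _ clX kX') (klft _ clY kY') (@lftD _) (@lftD _)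
  (compact_closed hS (clft _ (cl1 p))) (compact_closed hS (clft _ (cl1 q)))
  (lft0 p) (lft0 q) _ _.
- rewrite lftI; have -> : [set p] `&` [set q] = set0.
    by apply/seteqP; split=> // y [/= -> e]; move: pq; rewrite e eqxx.
  by rewrite /lft preimage_set0 image_set0.
- by rewrite lftI XYpq /lft preimage_setU image_setU.
apply: (OXY o Oo).
(* Both sets of the lemma are the union of the two lifted arcs, which is saturated; [O] would lie in
   the set that it avoids. *)
apply: (saturated_complement_empty dQ nQ oO OD OXY clO (fun _ => id) _ Oo).
move=> x y Dy XYx Qyx; have Dx : D x by case: XYx => /lftD.
pose u : set_type D := exist _ x (mem_set Dx); pose v : set_type D := exist _ y (mem_set Dy).
have e : plaque_pi u = plaque_pi v by apply/plaque_piE.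
by case: XYx => [/(lftP _ u)|/(lftP _ u)]; rewrite e => /lftP; [left|right].
Qed.

End PlaqueSpace.

Theorem proposition6p2p2 (R : realType) (S : metricType R)
    (F A : atlas_data S) :
  compact_surface S -> dendritation F ->
  is_atlas A -> complete_basis (atlas_cover A) -> subatlas A F ->
  exists2 delta0 : R, 0 < delta0 &
    forall delta : R, 0 < delta -> delta < delta0 ->
    forall U : set S, open U -> diam U < delta ->
    let D := closure U in
    closed_disc R D ->
    (forall x : S, D x -> dendrite R (set_type (plaques A D x))) /\
    dendrite R (plaque_space D (plaques A D)).
Proof.
move=> surfS [[[[aF [_ _]] lcF] _] [B [[aB [bB dwnB]] _ mB [e e0 he]] BF]] aA [bA dwnA] AF.
have cS := surfS.1; have hS := @metric_hausdorff R S.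
have [_ _ dF _] := aF; have [_ _ dA _] := aA.
(* D will lie in G.  Plaques of D are compared with those of closure V; the
   latter lie in open plaques of W, hence are meagre. *)
pose good (G : set S) := open G /\ exists V W E, [/\ open V, atlas_cover A V,
  closure V `<=` W, atlas_cover B W & diam (closure V) < e] /\
  [/\ G `<=` E, E `<=` V, compact E, @liftable R S E &
    forall D, D `<=` E -> compact D -> @liftable R S D -> cut_by_continua D].
have cov x : exists2 G, good G & G x.
  have [VA [AVA VAx] _] := bA.2 x setT filterT.
  have [W [BW Wx] _] := bB.2 x setT filterT.
  have oVA := bA.1 VA AVA; have oW := bB.1 W BW.
  have e4 : 0 < e / 4 by rewrite divr_gt0.
  have nVW : nbhs x (VA `&` W `&` ball x (e / 4)).
    apply: filterI; last exact: nbhsx_ballx.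
    by apply: filterI; exact: open_nbhs_nbhs.
  (* A closed neighbourhood is taken because [closure V], not only [V], must lie in [W] and in the
     ball; radius [e / 4] bounds its diameter by [e / 2]. *)
  have [V' nV' V'W] := @uniform_regular S x _ nVW.
  pose V := V'°; have oV : open V by exact: open_interior.
  have VW : closure V `<=` VA `&` W `&` ball x (e / 4).
    by apply: subset_trans V'W; apply: closureS; exact: interior_subset.
  have VS : V `<=` VA by move=> y /subset_closure/VW[[]].
  have [G [E [[oG Gx GE EV cE] [lE cutE]]]] := surface_local_disc surfS oV nV'.
  exists G => //; split=> //; exists V, W, E; split; split=> //.
  - exact: dwnA oV VS.
  - by move=> y /VW[[]].
  - apply: (@le_lt_trans _ _ (e / 4 + e / 4)); last by lra.
    apply: diam_le; first by rewrite addr_ge0// ltW.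
    move=> y z /VW[_ +] /VW[_]; rewrite ballEmdist /= metric_sym => yx xz.
    by apply: le_trans (metric_triangle y x z) _; rewrite lerD// ltW.
have [l l0 hl] : exists2 l : R, 0 < l & forall x, exists G : {G | good G},
    ball x l `<=` sval G.
  apply: lebesgue_number => // x; have [G gG Gx] := cov x.
  by exists (exist _ G gG) => //; case: gG.
(* Below [l] the disc fits into one good [G]; below [e] it is too small to contain a leaf of [B]. *)
exists (Num.min l e); first by rewrite lt_min l0.
move=> delta d0; rewrite lt_min => /andP[dl de] U oU dU D discD.
have cD : compact D by apply: subclosed_compact cS _ => //; exact: closed_closure.
have dD : diam D < delta by exact: le_lt_trans (diam_closure U cS) dU.
have [u Du] : exists u, D u.
  have [_ [g _]] := discD.
  have z0 : @closed_unit_disc R 0 by rewrite /closed_unit_disc /= expr0n addr0 ler01.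
  by exists (set_val (g (exist _ 0 (mem_set z0)))); exact: set_valP.
have [[G [oG [V [W [E [[oV AV VW BW dV] [GE EV cE lE cutE]]]]]]] /= uG] := hl u.
have DG : D `<=` G.
  move=> y Dy; apply: uG; rewrite ballEmdist /=.
  by apply: le_lt_trans (diam_ub cS Du Dy) (lt_trans dD dl).
have GV : G `<=` V by exact: subset_trans EV.
have AU : atlas_cover A U by apply: dwnA AV _ _ => // y Uy; exact/GV/DG/subset_closure.
have [FU eU] := AF U AU; have [FV eV] := AF V AV.
have lD : @liftable R S D by exact: closed_disc_liftable discD.
have cutD : cut_by_continua D.
  by apply: cutE => //; exact: subset_trans GE.
have clV y : V y -> closure V y by exact: subset_closure.
have EclV : E `<=` closure V by move=> y /EV/clV.
have DclV : D `<=` closure V by move=> y /DG/GV/clV.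
split; last first.
  apply: plaque_space_dendrite => //; first exact: dA.
  move=> y Dy; rewrite eU//.
  by apply: (plaque_reaches_frontier cS aF aB BF e0 he FU) => //; exact: lt_trans dD de.
move=> x Dx; rewrite eU//.
have [[_ QD cQ kQ] Qx] := decomposition_plaque (dF U FU) Dx.
have QV := plaque_subset aF FU FV DclV Dx.
(* Stated for plaques over [closure V] and continua in [E], because the neighbourhoods used for
   local connectedness may leave [D]. *)
have uni X Y M N : compact X -> compact Y -> connected X -> connected Y ->
    X `<=` E -> Y `<=` E -> X `|` Y `<=` plaques F (closure V) x ->
    closed M -> closed N -> M !=set0 -> N !=set0 -> M `&` N = set0 ->
    X `&` Y = M `|` N -> False.
  move=> cX cY kX kY XE YE.
  exact: (plaque_not_cut cS aF aB BF e0 he mB FV BW VW dV (DclV _ Dx) EclV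
    (cutE E (@subset_refl _ E) cE lE)).
split; last first.
  apply: no_curve_set_type => X Y M N cX cY kX kY XQ YQ.
  apply: (uni X Y M N) => //.
  - by move=> y /XQ/QD/DG/GE.
  - by move=> y /YQ/QD/DG/GE.
  - by move=> y [/XQ|/YQ] /QV.
split; first exact: set_type_continuum.
(* The open plaque over [V] through [x] contains the whole plaque over [D], its points on the
   frontier of [D] included. *)
apply: (plaque_locally_connected aF cS FV (GV _ (DG _ Dx)) _ oG GE _ GV cQ kQ Qx QV uni).
  by apply: lcF; exists V, x; split=> //; exact/GV/DG.
by move=> y /QD/DG.
Qed.
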